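(* Let $m\ge n$ and $d$ be positive integers, let $\ell=d^n(m-n)+n$ and let $L_j\in\mathbb{L}(m,1)$, $1\le j\le \ell$, be a system of independent linear functions. Then for any polynomial mapping $f:(\mathbb{C}^n,0)\to(\mathbb{C}^m,0)$ finite at $0$ with $\deg f\le d$ we have $$\mathcal{L}_0(f)=\min_{1\le i_1<\cdots<i_n\le \ell}\mathcal{L}_0((L_{i_1},\ldots,L_{i_n})\circ f).$$
   Context: $\mathbb{L}(m,1)$ is the set of linear functions $\mathbb{C}^m\to\mathbb{C}$; a system $L_1,\ldots,L_s\in\mathbb{L}(m,1)$, $s\ge m$, is independent if any $m$ of its members (with distinct indices) are linearly independent over $\mathbb{C}$. The notation $f:(\mathbb{C}^n,0)\to(\mathbb{C}^m,0)$ means $f(0)=0$; $f$ is finite at $0$ if $0$ is an isolated point of $f^{-1}(0)$; $\deg f$ is the maximum of the degrees of the components of $f$. The local {\L}ojasiewicz exponent $\mathcal{L}_0(g)$ of a holomorphic mapping $g:(\mathbb{C}^n,0)\to(\mathbb{C}^k,0)$ is the infimum of the set of all exponents $\nu\ge 1$ such that $|g(z)|\ge C|z|^\nu$ for some constant $C>0$ in a neighbourhood of the origin in $\mathbb{C}^n$ (with $\inf\emptyset=+\infty$). *)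

(* Defs.v *)
From HB Require Import structures.
From mathcomp Require Import all_boot all_order all_algebra.
From mathcomp Require Import complex.
From mathcomp Require Import all_classical all_reals all_analysis.
(* The notations of mpoly clash with those of mathcomp-analysis. *)
From mathcomp Require Import -(notations) mpoly.

Set Implicit Arguments.
Unset Strict Implicit.
Unset Printing Implicit Defensive.

Import Order.TTheory GRing.Theory Num.Theory.
Import numFieldNormedType.Exports.

Local Open Scope classical_set_scope.
Local Open Scope ring_scope.
Local Open Scope complex_scope.

(* The regular module R[i]^o is the copy of the complex numbers that carries
   the topology induced by the modulus; C^n has the product topology. *)
Notation Cvec R n := ('rV[R[i]^o]_n).

Definition enorm (R : realType) (n : nat) (z : Cvec R n) : R :=
  Num.sqrt (\sum_(k < n) ComplexField.Normc.normc (z 0 k) ^+ 2).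

Definition loja_exponents (R : realType) (n k : nat)
    (g : Cvec R n -> Cvec R k) : set R :=
  [set nu | 1 <= nu /\
    exists2 c : R, 0 < c &
      \forall z \near (0 : Cvec R n), c * enorm z `^ nu <= enorm (g z)].

(* [ereal_inf set0 = +oo]. *)
Definition loja (R : realType) (n k : nat) (g : Cvec R n -> Cvec R k) :
    \bar R :=
  ereal_inf [set nu%:E | nu in loja_exponents g].

Definition finite_at0 (R : realType) (n k : nat)
    (g : Cvec R n -> Cvec R k) : Prop :=
  isolated (g @^-1` [set 0]) 0.

Definition polymap (R : realType) (n m : nat) (f : 'I_m -> mpoly n R[i]) :
    Cvec R n -> Cvec R m :=
  fun z => \row_j meval (z 0) (f j).

(* [msize p] is [1 + deg p], and 0 for p = 0: the zero polynomial is thus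
   counted as having degree 0. *)
Definition deg_polymap (R : realType) (n m : nat)
    (f : 'I_m -> mpoly n R[i]) : nat :=
  \max_(j < m) (msize (f j)).-1.

Definition linform (R : realType) (m : nat) := 'Hom(Cvec R m, R[i]^o).

Definition independent (R : realType) (m s : nat)
    (L : 'I_s -> linform R m) : Prop :=
  (m <= s)%N /\
  forall i : 'I_m -> 'I_s, injective i -> free [seq L (i k) | k : 'I_m].

Definition linmap (R : realType) (m s n : nat) (L : 'I_s -> linform R m)
    (i : n.-tuple 'I_s) : Cvec R m -> Cvec R n :=
  fun w => \row_k L (tnth i k) w.

(* Main.v *)
Require Import Defs.
From HB Require Import structures.
From mathcomp Require Import all_boot all_order all_algebra zify ring lra.
From mathcomp Require Import complex.
From mathcomp Require Import all_classical all_reals all_analysis.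
From mathcomp Require Import -(notations) mpoly.

(* Write |.| for the norm and call C the cone of limits of multiples c f(z),
   z -> 0.  If n of the forms L_j have no common zero on C \ {0}, then
   |f| <= const |L_I o f| near 0, so both maps have the same Lojasiewicz
   exponent; every other choice of I only increases the exponent.

   Such an I is found by exchanging, one at a time, the forms of a generic
   tuple U_1, ..., U_n with the same property (Noether normalisation) for L_j's.
   When U_k is to be exchanged, the common zeros on C of the n - 1 other forms
   are at most d^n lines, and each of these lies in at most m - n of the kernels
   of the L_j's not chosen yet, since any m of the forms involved are
   independent: at most d^n (m - n) of the L_j's are lost.

   For the bound d^n: n + 1 polynomials of degree <= d in n variables satisfy a
   relation of degree <= d^n in the last one, because the number of monomials
   available exceeds the dimension of their target.  The lowest form Q of the
   relation between the n forms and a form H separating the lines vanishes on C.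
   If Q vanishes identically over the point w defining the lines, it is divided
   by a power of the coordinate c on a line w + c v, which gives a nonzero
   polynomial S of degree <= d^n.  That H is a root of S on each of the lines is
   a form of purity of the tangent cone.  Otherwise the values of H on the fibre
   over w would be a bounded set which is open away from the roots of S: openness
   follows by lifting a segment through a polynomial map C^n -> C^n, after a
   perturbation that makes the segment avoid the critical values. *)

Set Implicit Arguments.
Unset Strict Implicit.
Unset Printing Implicit Defensive.
Import Order.TTheory GRing.Theory Num.Theory.
Import numFieldNormedType.Exports.
Local Open Scope ring_scope.

(** * Algebraic relations between polynomials *)

Lemma base_expansion_inj (b n : nat) (f g : nat -> nat) :
  (forall i, i < n -> f i < b)%N -> (forall i, i < n -> g i < b)%N ->
  (\sum_(i < n) f i * b ^ i = \sum_(i < n) g i * b ^ i)%N ->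
  forall i, (i < n)%N -> f i = g i.
Proof.
elim: n f g => [|n IHn] f g fb gb; first by [].
rewrite !big_ord_recl !expn0 !muln1.
have E (h : nat -> nat) : (\sum_(i < n) h (lift ord0 i) * b ^ lift ord0 i =
            (\sum_(i < n) h i.+1 * b ^ i) * b)%N.
  by rewrite big_distrl; apply: eq_bigr => i _; rewrite lift0 expnSr mulnA.
rewrite !E => eq_fg.
have f0 : f 0%N = g 0%N.
  have := congr1 (modn^~ b) eq_fg.
  by rewrite ![(_ 0 + _)%N]addnC !modnMDl !modn_small ?fb ?gb.
have b_gt0 : (0 < b)%N by apply: leq_ltn_trans (fb 0%N _).
move: eq_fg; rewrite f0 => /addnI /eqP; rewrite eqn_pmul2r // => /eqP eq_fg.
have {}IHn := IHn (f \o succn) (g \o succn) (fun i => fb i.+1) (fun i => gb i.+1) eq_fg.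
by case=> [|i] //; exact: IHn.
Qed.

(** With [b] above every exponent of [p], substituting [x ^+ (b ^ i)] for the [i]-th variable sends
    distinct monomials of [p] to distinct powers of [x], by uniqueness of base [b] digits. The
    resulting nonzero univariate polynomial cannot vanish at all of 0, ..., [size q - 1]. *)
Lemma mpoly_neq0_meval (K : numFieldType) (n : nat) (p : mpoly n K) :
  p != 0 -> exists v, meval v p != 0.
Proof.
move=> p0; pose b := msize p.
pose e (m : multinom n) := (\sum_(i < n) m i * b ^ i)%N.
have e_inj : {in msupp p &, injective e}.
  have mb m : m \in msupp p -> forall i, (m i < b)%N.
    move=> mp i; apply: leq_ltn_trans (msize_mdeg_lt mp).
    by rewrite mdegE (bigD1 i) //= leq_addr.
  move=> m1 m2 m1p m2p.
  pose g (m : multinom n) (i : nat) := if insub i is Some j then m j else 0%N.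
  have gE m (i : 'I_n) : g m i = m i by rewrite /g valK.
  have eE m : e m = (\sum_(i < n) g m i * b ^ i)%N by apply: eq_bigr => i _; rewrite gE.
  rewrite !eE.
  have gb m : m \in msupp p -> forall j, (j < n -> g m j < b)%N.
    by move=> mp j ltj; rewrite -[j]/(val (Ordinal ltj)) gE mb.
  move/(base_expansion_inj (gb _ m1p) (gb _ m2p)) => eqg; apply/mnmP => i.
  by rewrite -!gE eqg.
pose q : {poly K} := \sum_(m <- msupp p) mcoeff m p *: 'X^(e m).
have [m mp] : exists m, m \in msupp p.
  case E : (msupp p) => [|m s]; first by move/eqP: E; rewrite msupp_eq0 (negPf p0).
  by exists m; rewrite mem_head.
have q0 : q != 0.
  apply/eqP => /(congr1 (fun q : {poly K} => q`_(e m))).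
  rewrite coef0 coef_sum (bigD1_seq m) //= coefZ coefXn eqxx mulr1.
  rewrite big_seq_cond big1 => [|m' /andP[m'p l1norm]]; last first.
    rewrite coefZ coefXn; case: eqP => [eqe|]; last by rewrite mulr0.
    by rewrite (e_inj _ _ mp m'p eqe) eqxx in l1norm.
  by apply/eqP; rewrite addr0 -mcoeff_msupp.
have [x qx] : exists x, q.[x] != 0.
  have uniq_s : uniq [seq (i%:R : K) | i <- iota 0 (size q)].
    rewrite map_inj_in_uniq ?iota_uniq // => i j _ _ /eqP.
    by rewrite eqr_nat => /eqP.
  have [/allP all_root|] := boolP (all (root q) [seq (i%:R : K) | i <- iota 0 (size q)]).
    have := max_poly_roots q0 (introT allP all_root) uniq_s.
    by rewrite size_map size_iota ltnn.
  by case/allPn => x _; exists x.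
(* Kronecker substitution *)
exists (fun i => x ^+ (b ^ i)); rewrite mevalE.
suff -> : \sum_(m <- msupp p) mcoeff m p * \prod_(i < n) (x ^+ (b ^ i)) ^+ m i = q.[x] by [].
rewrite horner_sum; apply: eq_bigr => m' _; rewrite hornerZ hornerXn; congr (_ * _).
rewrite /e -[RHS](_ : \prod_(i < n) x ^+ (m' i * b ^ i) = _).
  by apply: eq_bigr => i _; rewrite -exprM mulnC.
by elim/big_rec2: _ => [|i y1 y2 _ ->]; rewrite ?expr0 ?exprD.
Qed.

(** Denominator-free form of (1 + 1/K)^k (1 - k/K) <= 1. *)
Lemma exp_succ_bound (k K : nat) : (k <= K -> K.+1 ^ k * (K - k) <= K ^ k * K)%N.
Proof.
elim: k => [|k IHk] ltkK; first by rewrite subn0.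
have := IHk (ltnW ltkK).
rewrite !expnSr; set a := (_ ^ _)%N; set c := (_ ^ _)%N => le_ac.
have : (K.+1 * (K - k.+1) <= (K - k) * K)%N by nia.
by move=> le2; nia.
Qed.

(** The left side counts monomials of degree at most d (N + d^k) in n variables; the right side
    counts those in k + 1 variables with degree at most d^k in the last one and total degree at most
    N in the others. For n = k and large N they grow like d^k N^k / k! and (d^k + 1) N^k / k!. *)
Lemma simplex_count_lt (k n d : nat) : (0 < d)%N -> (n <= k)%N ->
  exists N, ('C(n + d * (N + d ^ k), n) < (d ^ k).+1 * 'C(k + N, k))%N.
Proof.
move=> d_gt0 le_nk; set D := (d ^ k)%N.
have expn_prod a : (\prod_(i < k) a = a ^ k)%N by rewrite prod_nat_const card_ord.
have D_gt0 : (0 < D)%N by rewrite expn_gt0 d_gt0.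
(* Since N + D = D (K + 1), each factor of the left product exceeds the matching factor of [B] by a
   ratio at most (K + 1) / K. The choice of [K] gives D K < (D + 1)(K - k), so that the k-th power
   of this ratio stays below (D + 1) / D. *)
pose K := (k * D.+1).+1; exists (D * K)%N; set N := (D * K)%N.
apply: (@leq_ltn_trans 'C(k + d * (N + D), k)).
  set M := (d * _)%N.
  have -> : 'C(n + M, n) = 'C(n + M, M) by rewrite -bin_sub ?leq_addr // addKn.
  have -> : 'C(k + M, k) = 'C(k + M, M) by rewrite -[in RHS]bin_sub ?leq_addl // addnK.
  by apply: leq_bin2l; rewrite leq_add2r.
rewrite -(@ltn_pmul2r k`!) ?fact_gt0 // -mulnA !bin_ffact !ffact_prod.
set B := (X in (_ < _ * X)%N).
have B_gt0 : (0 < B)%N by apply: prodn_gt0 => i; have := ltn_ord i; nia.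
have le1 : (\prod_(i < k) (k + d * (N + D) - i) <=
            D * \prod_(i < k) (k + N + D - i))%N.
  rewrite {2}/D -expn_prod -big_split /=; apply: leq_prod => i _.
  by have := ltn_ord i; nia.
have le2 : (K ^ k * \prod_(i < k) (k + N + D - i) <= K.+1 ^ k * B)%N.
  rewrite /B -!expn_prod -!big_split /=; apply: leq_prod => i _.
  by have := ltn_ord i; rewrite /N; nia.
have le3 : (D * K.+1 ^ k < D.+1 * K ^ k)%N.
  have leK : (k <= K)%N by rewrite /K; nia.
  have := exp_succ_bound leK.
  have Kk : (0 < K ^ k)%N by rewrite expn_gt0.
  have : (D * K < D.+1 * (K - k))%N by rewrite /K; nia.
  move: (K ^ k)%N (K.+1 ^ k)%N Kk => a c a0 lt1 lt2.
  rewrite ltnNge; apply/negP => le4.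
  have : (D.+1 * a * (K - k) <= D * c * (K - k))%N by rewrite leq_mul2r le4 orbT.
  have : (D * (c * (K - k)) <= D * (a * K))%N by rewrite leq_mul2l lt2 orbT.
  have : (a * (D * K) < a * (D.+1 * (K - k)))%N by rewrite ltn_pmul2l.
  by lia.
have Kk : (0 < K ^ k)%N by rewrite expn_gt0.
apply: leq_ltn_trans le1 _; rewrite -(ltn_pmul2l Kk).
apply: (@leq_ltn_trans (D * K.+1 ^ k * B)%N).
  by rewrite -mulnA mulnCA leq_mul2l le2 orbT.
by rewrite mulnA (mulnC (K ^ k)%N) ltn_pmul2r.
Qed.

Lemma msizeM_pred (R : idomainType) (n : nat) (p q : mpoly n R) :
  (msize (p * q) <= (msize p + msize q).-1)%N.
Proof.
have [->|p0] := eqVneq p 0; first by rewrite mul0r msize0.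
have [->|q0] := eqVneq q 0; first by rewrite mulr0 msize0.
by rewrite msizeM.
Qed.

Lemma msize_expr (R : idomainType) (n d e : nat) (p : mpoly n R) :
  (msize p <= d.+1)%N -> (msize (p ^+ e) <= (d * e).+1)%N.
Proof.
move=> le_pd; elim: e => [|e IHe]; first by rewrite expr0 msize1.
rewrite exprS; have := msizeM_pred p (p ^+ e); lia.
Qed.

Lemma msize_prod_expr (R : idomainType) (n N d : nat) (F : 'I_N -> mpoly n R)
    (e : 'I_N -> nat) : (forall i, msize (F i) <= d.+1)%N ->
  (msize (\prod_(i < N) F i ^+ e i) <= (d * \sum_(i < N) e i).+1)%N.
Proof.
move=> leF; elim/big_rec2: _ => [|i s p _ le_p]; first by rewrite msize1.
have := msizeM_pred (F i ^+ e i) p; have := msize_expr (e i) (leF i).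
rewrite mulnDr; lia.
Qed.

Lemma sum_tnth (n N : nat) (t : n.-tuple 'I_N) :
  (\sum_(i <- t) i = \sum_(i < n) tnth t i)%N.
Proof. exact: big_tuple. Qed.

(** A Perron-type bound on the degree in the last variable alone. The products of powers of the
    [F i] with exponents in [A] have degree at most [M] and outnumber the monomials of degree at
    most [M]; the coefficients of a linear dependence between them are those of [P]. *)
Lemma algebraic_relation (K : fieldType) (n k d : nat) (F : 'I_(k + 1) -> mpoly n K) :
  (0 < d)%N -> (n <= k)%N -> (forall i, msize (F i) <= d.+1)%N ->
  exists P : mpoly (k + 1) K,
    [/\ P != 0,
        forall m, m \in msupp P -> (m (rshift k ord0) <= d ^ k)%N
      & forall z, meval (fun i => meval z (F i)) P = 0].
Proof.
move=> d_gt0 le_nk leF; have [N ltN] := simplex_count_lt d_gt0 le_nk.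
set D := (d ^ k)%N in ltN *; pose M := (d * (N + D))%N.
pose A := finset.setX [set: 'I_D.+1]
            [set t : k.-tuple 'I_N.+1 | (\sum_(i <- t) i <= N)%N].
pose B := [set t : n.-tuple 'I_M.+1 | (\sum_(i <- t) i <= M)%N].
have cardA : #|A| = (D.+1 * 'C(k + N, k))%N.
  by rewrite cardsX cardsT card_ord card_partial_ord_partitions.
have cardB : #|B| = 'C(n + M, n) by rewrite card_partial_ord_partitions.
pose monA (a : 'I_D.+1 * k.-tuple 'I_N.+1) : multinom (k + 1) :=
  Multinom [tuple match fintype.split i with inl j => tnth a.2 j : nat | inr _ => a.1 : nat end
           | i < k + 1].
have monAl a j : monA a (lshift 1 j) = tnth a.2 j.
  by rewrite multinomE tnth_mktuple -[lshift 1 j]/(unsplit (inl j)) unsplitK.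
have monAr a j : monA a (rshift k j) = a.1.
  by rewrite multinomE tnth_mktuple -[rshift k j]/(unsplit (inr j)) unsplitK.
have monA_inj : injective monA.
  move=> a b eq_ab; rewrite [a]surjective_pairing [b]surjective_pairing.
  congr (_, _); first by apply: val_inj; rewrite /= -(monAr a ord0) eq_ab monAr.
  apply: eq_from_tnth => j; apply: val_inj.
  by rewrite /= -!monAl eq_ab.
pose monB (b : n.-tuple 'I_M.+1) : multinom n := Multinom [tuple tnth b i : nat | i < n].
pose Fa a := \prod_(i < k + 1) F i ^+ monA a i.
have sizeFa a : a \in A -> (msize (Fa a) <= M.+1)%N.
  case: a => x t; rewrite !inE /= => let_N.
  have := msize_prod_expr (monA (x, t)) leF => /leq_trans; apply.
  rewrite ltnS leq_pmul2l // big_split_ord /= big_ord1 monAr /=.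
  rewrite (eq_bigr (fun i => tnth t i : nat)); last by move=> i _; rewrite monAl.
  by rewrite -sum_tnth; have := ltn_ord x; rewrite /M; lia.
pose Mx : 'M[K]_(#|A|, #|B|) :=
  \matrix_(a, b) mcoeff (monB (enum_val b)) (Fa (enum_val a)).
have [c c0 cMx] : exists2 c : 'rV_#|A|, c != 0 & c *m Mx = 0.
  have : kermx Mx != 0.
    rewrite kermx_eq0 /row_free neq_ltn (leq_ltn_trans (rank_leq_col _)) //.
    by rewrite cardA cardB.
  by case/rowV0Pn => c /sub_kermxP cM c0; exists c.
pose P : mpoly (k + 1) K := \sum_(a < #|A|) c 0 a *: mpolyX K (monA (enum_val a)).
have coefP a : mcoeff (monA (enum_val a)) P = c 0 a.
  rewrite /P (raddf_sum (mcoeff (monA (enum_val a)))) (bigD1 a) //=.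
  rewrite mcoeffZ mcoeffX eqxx mulr1.
  rewrite big1 ?addr0 // => b nab; rewrite mcoeffZ mcoeffX.
  case: eqP => [/monA_inj/enum_val_inj eqab|]; last by rewrite mulr0.
  by rewrite eqab eqxx in nab.
exists P; split.
- case/rV0Pn: c0 => a ca; apply: contraNneq ca => P0.
  by rewrite -coefP P0 mcoeff0.
- move=> m; rewrite mcoeff_msupp => Pm.
  have /existsP[a /eqP->] : [exists a : 'I_#|A|, m == monA (enum_val a)].
    apply: contraNT Pm; rewrite negb_exists => /forallP l1norm.
    rewrite /P (raddf_sum (mcoeff m)) big1 // => a _.
    by rewrite /= mcoeffZ mcoeffX eq_sym (negPf (l1norm a)) mulr0.
  by rewrite monAr -ltnS ltn_ord.
have PF : \sum_(a < #|A|) c 0 a *: Fa (enum_val a) = 0.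
  apply/mpolyP => m; rewrite mcoeff0.
  have [le_m|lt_m] := leqP (mdeg m) M; last first.
    rewrite (raddf_sum (mcoeff m)) big1 //= => a _; rewrite mcoeffZ; apply/eqP.
    rewrite mulf_eq0 mcoeff_eq0 msize_mdeg_ge ?orbT //.
    by apply: leq_trans lt_m; apply/sizeFa/enum_valP.
  have mM i : (m i < M.+1)%N.
    by rewrite ltnS; apply: leq_trans le_m; rewrite mdegE (bigD1 i) //= leq_addr.
  pose t := [tuple Ordinal (mM i) | i < n].
  have tB : t \in B.
    rewrite inE sum_tnth; apply: leq_trans le_m; rewrite mdegE leq_sum // => i _.
    by rewrite tnth_mktuple.
  have mE : m = monB (enum_val (enum_rank_in tB t)).
    rewrite enum_rankK_in //; apply/mnmP => i.
    by rewrite multinomE tnth_mktuple tnth_mktuple.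
  have := congr1 (fun u : 'rV_#|B| => u 0 (enum_rank_in tB t)) cMx.
  rewrite mxE [RHS]mxE => <-; rewrite (raddf_sum (mcoeff m)); apply: eq_bigr => a _.
  by rewrite mxE -mE /= mcoeffZ.
move=> z; rewrite -[RHS](meval0 z) -PF !(raddf_sum (meval _)) /=.
apply: eq_bigr => a _; rewrite !mevalZ mevalX /Fa rmorph_prod; congr (_ * _).
by apply: eq_bigr => i _; rewrite rmorphXn.
Qed.

Lemma msupp_argmin (R : nzRingType) (n : nat) (p : mpoly n R) (e : multinom n -> nat) :
  p != 0 -> exists2 m, m \in msupp p & forall m', m' \in msupp p -> (e m <= e m')%N.
Proof.
rewrite -msupp_eq0; case E : (msupp p) => [//|m0 s] _.
have ex : exists k, has (fun m => e m == k) (m0 :: s).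
  by exists (e m0); rewrite /= eqxx.
case: (ex_minnP ex) => k /hasP[m ms /eqP emk] min_k; exists m => // m' m's.
by rewrite emk; apply: min_k; apply/hasP; exists m'.
Qed.

(** [Q] is the lowest homogeneous part of [P], of degree [s], and [G] is the deformation of [P] to
    [Q]: G(x, c) = P(c x) / c^s, extended to c = 0. Limits with c tending to 0 then reduce to the
    continuity of [G]. *)
Lemma lowest_form (K : fieldType) (n : nat) (P : mpoly n K) : P != 0 ->
  exists s (Q : mpoly n K) (G : mpoly (n + 1) K),
    [/\ Q != 0, {subset msupp Q <= msupp P},
        forall c x, meval ((c *: x : 'rV_n) 0) Q = c ^+ s * meval (x 0) Q,
        forall c x, meval ((c *: x : 'rV_n) 0) P =
                    c ^+ s * meval (row_mx x (c%:M : 'M[K]_1) 0) G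
      & forall x : 'rV_n, meval (row_mx x (0%:M : 'M[K]_1) 0) G = meval (x 0) Q].
Proof.
move=> P0; have [m0 m0P min_m0] := msupp_argmin (@mdeg n) P0.
pose s := mdeg m0.
pose Q := \sum_(m <- msupp P | mdeg m == s) mcoeff m P *: mpolyX K m.
have coefQ m : m \in msupp P -> mdeg m == s -> mcoeff m Q = mcoeff m P.
  move=> mP ms; rewrite /Q (raddf_sum (mcoeff m)) big_mkcond (bigD1_seq m) //=.
  rewrite ms mcoeffZ mcoeffX eqxx mulr1 big1 ?addr0 // => m' l1norm; case: ifP => // _.
  by rewrite mcoeffZ mcoeffX (negPf l1norm) mulr0.
(* The truncated difference [mdeg m - s] is a genuine one on the support of [P], where [s] is the
   least degree. *)
pose ex (m : multinom n) : multinom (n + 1) :=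
  Multinom [tuple match fintype.split i with inl j => m j | inr _ => (mdeg m - s)%N end | i < n + 1].
pose G := \sum_(m <- msupp P) mcoeff m P *: mpolyX K (ex m).
have evG x c : meval (row_mx x (c%:M : 'M[K]_1) 0) G =
    \sum_(m <- msupp P) mcoeff m P * ((\prod_i x 0 i ^+ m i) * c ^+ (mdeg m - s)).
  rewrite /G (raddf_sum (meval _)); apply: eq_bigr => m _.
  rewrite /= mevalZ mevalX big_split_ord /= big_ord1; congr (_ * (_ * _)).
    apply: eq_bigr => i _; rewrite row_mxEl multinomE tnth_mktuple.
    by rewrite -[lshift 1 i]/(unsplit (inl i)) unsplitK.
  rewrite row_mxEr mxE multinomE tnth_mktuple.
  by rewrite -[rshift n ord0]/(unsplit (inr ord0)) unsplitK.
have evQ (x : 'rV_n) : meval (x 0) Q =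
    \sum_(m <- msupp P | mdeg m == s) mcoeff m P * \prod_i x 0 i ^+ m i.
  rewrite /Q (raddf_sum (meval _)); apply: eq_bigr => m _.
  by rewrite /= mevalZ mevalX.
have prodZ (c : K) (x : 'rV_n) (m : multinom n) : \prod_i (c *: x) 0 i ^+ m i =
    c ^+ mdeg m * \prod_i x 0 i ^+ m i.
  rewrite mdegE -prodrXr; rewrite -big_split /=; apply: eq_bigr => i _.
  by rewrite mxE exprMn.
exists s, Q, G; split.
- by apply/eqP => Q0; have := m0P; rewrite mcoeff_msupp -coefQ // Q0 mcoeff0 eqxx.
- move=> m; rewrite !mcoeff_msupp; apply: contraNneq => Pm.
  rewrite /Q (raddf_sum (mcoeff m)) big1 // => m' _ /=; rewrite mcoeffZ mcoeffX.
  by case: eqP => [->|]; rewrite ?Pm ?mul0r ?mulr0.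
- move=> c x; rewrite !evQ big_distrr /=; apply: eq_bigr => m /eqP ms.
  by rewrite prodZ ms mulrCA.
- move=> c x; rewrite evG mevalE big_distrr /= big_seq [RHS]big_seq.
  apply: eq_bigr => m mP; rewrite prodZ -{1}(subnK (min_m0 _ mP)) addnC exprD.
  by rewrite -/s; ring.
- move=> x; rewrite evG evQ [RHS]big_mkcond big_seq [RHS]big_seq.
  apply: eq_bigr => m mP; have := min_m0 _ mP; rewrite leq_eqVlt -/s eq_sym.
  case: eqP => [-> _|/= _ lt_s]; first by rewrite subnn mulr1.
  by rewrite expr0n subn_eq0 leqNgt lt_s /= !mulr0.
Qed.

(** The power is taken out of the inner variable. If all coefficients vanish at 0 they are divided
    by ['X], which shortens the leading coefficient; hence the induction on its size. *)
Lemma poly_factor_X (K : fieldType) (B : {poly {poly K}}) : B != 0 ->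
  exists a B', B = ('X ^+ a) *: B' /\ map_poly (horner_eval 0) B' != 0.
Proof.
have [N le_N] := ubnP (size (lead_coef B)); elim: N B le_N => // N IHN B le_N B0.
have [B00|] := eqVneq (map_poly (horner_eval (0 : K)) B) 0; last first.
  by exists 0%N, B; rewrite expr0 scale1r.
pose B1 : {poly {poly K}} := \poly_(i < size B) (B`_i %/ 'X).
have BE : B = 'X *: B1.
  apply/polyP => i; rewrite coefZ coef_poly.
  case: ltnP => [_|le_i]; last by rewrite mulr0 nth_default.
  rewrite mulrC divpK // -['X]subr0 -polyC0 dvdp_XsubCl /root.
  by have := congr1 (fun q : {poly K} => q`_i) B00; rewrite coef_map coef0 => /eqP.
have B10 : B1 != 0 by apply: contraNneq B0 => B10; rewrite BE B10 scaler0.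
have lcB : lead_coef B = 'X * lead_coef B1 by rewrite BE lead_coefZ.
have : (size (lead_coef B1) < N)%N.
  move: le_N; rewrite lcB mulrC size_mulX ?lead_coef_eq0 //.
case/IHN => // a [B' [B1E B'0]]; exists a.+1, B'; split=> //.
by rewrite BE B1E scalerA exprS.
Qed.

(** The restriction of [Q] is read as a polynomial in the outer variable [t] with coefficients
    polynomial in the inner variable [c]. Dividing by the highest power of [c] leaves something
    nonzero at c = 0, namely [R]. *)
Lemma restrict_to_line (K : fieldType) (n D : nat) (Q : mpoly (n + 1) K) (w v : 'rV[K]_n) :
  (forall m, m \in msupp Q -> (m (rshift n ord0) <= D)%N) ->
  (exists c t, meval (row_mx (w + c *: v) (t%:M : 'M[K]_1) 0) Q != 0) ->
  exists a (B : {poly {poly K}}) (R : {poly K}),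
    [/\ R != 0, (size R <= D.+1)%N, forall t, B.[t%:P].[0] = R.[t]
      & forall c t, meval (row_mx (w + c *: v) (t%:M : 'M[K]_1) 0) Q =
                    c ^+ a * B.[t%:P].[c]].
Proof.
move=> degQ [c0 [t0 Q0]].
pose l (i : 'I_n) : {poly K} := (w 0 i)%:P + v 0 i *: 'X.
pose A : {poly {poly K}} := \sum_(m <- msupp Q)
  (mcoeff m Q *: \prod_i l i ^+ m (lshift 1 i)) *: 'X^(m (rshift n ord0)).
have evA c t : meval (row_mx (w + c *: v) (t%:M : 'M[K]_1) 0) Q = A.[t%:P].[c].
  rewrite mevalE /A !horner_sum; apply: eq_bigr => m _.
  rewrite !hornerE big_split_ord /= big_ord1 row_mxEr mxE eqxx mulr1n.
  rewrite horner_prod mulrA; congr (_ * _ * _).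
  apply: eq_bigr => i _; rewrite row_mxEl !mxE horner_exp /l !hornerE.
  by rewrite [c * _]mulrC.
have A0 : A != 0.
  by apply: contraNneq Q0 => A0; rewrite evA A0 !horner0.
have [a [B [AE B0]]] := poly_factor_X A0.
have sizeA : (size A <= D.+1)%N.
  apply: leq_trans (size_sum _ _ _) _; rewrite big_seq; apply/bigmax_leqP_seq => m _ mQ.
  by apply: leq_trans (size_scale_leq _ _) _; rewrite size_polyXn ltnS degQ.
exists a, B, (map_poly (horner_eval 0) B); split=> //.
- apply: leq_trans (size_poly _ _) _; move: sizeA.
  by rewrite AE size_scale // expf_neq0 // polyX_eq0.
- move=> t; rewrite -[RHS](_ : (map_poly (horner_eval 0) B).[horner_eval 0 t%:P] = _).
    by rewrite horner_map.
  by rewrite /= /horner_eval hornerC.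
- by move=> c t; rewrite evA AE !hornerE.
Qed.

(* [D] is the part of lowest degree in [J] of a relation between [F] and [J]. *)
Lemma critical_values_polynomial (K : numFieldType) (n : nat)
    (F : 'I_n -> mpoly n K) (J : mpoly n K) : J != 0 ->
  exists2 D : mpoly n K, D != 0 &
    forall z, meval z J = 0 -> meval (fun i => meval z (F i)) D = 0.
Proof.
move=> J0.
pose F1 (i : 'I_(n + 1)) := match fintype.split i with inl j => F j | inr _ => J end.
have F1l j : F1 (lshift 1 j) = F j.
  by rewrite /F1 -[lshift 1 j]/(unsplit (inl j)) unsplitK.
have F1r j : F1 (rshift n j) = J.
  by rewrite /F1 -[rshift n j]/(unsplit (inr j)) unsplitK.
pose d := (\max_i msize (F1 i)).+1.
have leF i : (msize (F1 i) <= d.+1)%N.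
  by rewrite /d; apply: leq_trans (leqW (leqnSn _)); exact: (leq_bigmax i).
have [P [P0 _ PF]] := algebraic_relation (ltn0Sn _) (leqnn n) leF.
pose T (m : multinom (n + 1)) := m (rshift n ord0).
have [m0 m0P min_m0] := msupp_argmin T P0.
pose a := T m0.
(* [q] is the relation P(F, J) = 0 divided by J^a, which is legitimate in an integral domain. Where
   [J] vanishes, only the terms with [T m = a] survive in [q]. *)
pose q := \sum_(m <- msupp P) mcoeff m P *:
  ((\prod_i F i ^+ m (lshift 1 i)) * J ^+ (T m - a)).
have evq z : meval z q = \sum_(m <- msupp P) mcoeff m P *
    ((\prod_i meval z (F i) ^+ m (lshift 1 i)) * meval z J ^+ (T m - a)).
  rewrite /q (raddf_sum (meval z)); apply: eq_bigr => m _ /=.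
  rewrite mevalZ mevalM rmorph_prod rmorphXn; congr (_ * (_ * _)).
  by apply: eq_bigr => i _; rewrite rmorphXn.
have q0 : q = 0.
  have Jaq : J ^+ a * q = 0.
    apply/eqP; apply: contraT => /mpoly_neq0_meval[z]; rewrite mevalM rmorphXn /=.
    suff -> : meval z J ^+ a * meval z q = meval (fun i => meval z (F1 i)) P.
      by rewrite PF eqxx.
    rewrite [RHS]mevalE evq big_distrr /= big_seq [RHS]big_seq.
    apply: eq_bigr => m mP; rewrite big_split_ord /= big_ord1 F1r -/(T m).
    have -> : \prod_(i < n) meval z (F1 (lshift 1 i)) ^+ m (lshift 1 i) =
              \prod_(i < n) meval z (F i) ^+ m (lshift 1 i).
      by apply: eq_bigr => i _; rewrite F1l.
    by rewrite -{2}(subnK (min_m0 _ mP)) -/a exprD; ring.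
  by move/eqP: Jaq; rewrite mulf_eq0 expf_eq0 (negPf J0) andbF => /eqP.
pose re (m : multinom (n + 1)) : multinom n := Multinom [tuple m (lshift 1 i) | i < n].
have re_inj m m' : T m = T m' -> re m = re m' -> m = m'.
  move=> eqT eqre; apply/mnmP => i; rewrite -(splitK i); case: (fintype.split i) => j /=.
    have := congr1 (fun m : multinom n => m j) eqre.
    by rewrite !multinomE !tnth_mktuple.
  by rewrite (ord1 j).
pose D := \sum_(m <- msupp P | T m == a) mcoeff m P *: mpolyX K (re m).
exists D.
  apply/eqP => D0; have := congr1 (mcoeff (re m0)) D0.
  rewrite mcoeff0 /D (raddf_sum (mcoeff _)).
  rewrite big_mkcond (bigD1_seq m0) //= eqxx mcoeffZ mcoeffX eqxx mulr1.
  rewrite big1 ?addr0; first by move/eqP; rewrite mcoeff_eq0 m0P.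
  move=> m l1norm; case: eqP => // Tm; rewrite mcoeffZ mcoeffX.
  case: eqP => [eqre|]; last by rewrite mulr0.
  by rewrite (re_inj m m0) ?eqxx in l1norm.
move=> z Jz; have := congr1 (meval z) q0; rewrite meval0 evq => q0z.
rewrite -[RHS]q0z /D (raddf_sum (meval _)) big_mkcond big_seq [RHS]big_seq.
apply: eq_bigr => m mP; rewrite Jz expr0n subn_eq0.
have := min_m0 _ mP; rewrite leq_eqVlt -/a eq_sym; case: eqP => [-> _|/= _ lt_a].
  rewrite leqnn mulr1 /= mevalZ mevalX; congr (_ * _); apply: eq_bigr => i _.
  by rewrite multinomE tnth_mktuple.
by rewrite leqNgt lt_a /= !mulr0.
Qed.

(** * The l1 norm on complex vectors *)

Local Open Scope classical_set_scope.
Local Open Scope ring_scope.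
Local Open Scope complex_scope.

Notation cabs := ComplexField.Normc.normc.

Section ComplexModulus.
Variable R : realType.
Implicit Types x y : R[i].

Lemma cabs_ge0 x : 0 <= cabs x.
Proof. by case: x => a b; exact: sqrtr_ge0. Qed.

Lemma cabs0 : cabs (0 : R[i]) = 0.
Proof. exact: ComplexField.Normc.normc0. Qed.

Lemma cabs1 : cabs (1 : R[i]) = 1.
Proof. exact: ComplexField.Normc.normc1. Qed.

Lemma cabsM x y : cabs (x * y) = cabs x * cabs y.
Proof. exact: ComplexField.Normc.normcM. Qed.

Lemma cabsD x y : cabs (x + y) <= cabs x + cabs y.
Proof. exact: le_normcD. Qed.

Lemma cabsN x : cabs (- x) = cabs x.
Proof. exact: normcN. Qed.

Lemma cabs_eq0 x : (cabs x == 0) = (x == 0).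
Proof.
apply/eqP/eqP => [|->]; last exact: cabs0.
exact: ComplexField.Normc.eq0_normc.
Qed.

Lemma cabs_gt0 x : (0 < cabs x) = (x != 0).
Proof. by rewrite lt_neqAle cabs_ge0 andbT eq_sym cabs_eq0. Qed.

Lemma cabsV x : cabs x^-1 = (cabs x)^-1.
Proof. exact: ComplexField.Normc.normcV. Qed.

Lemma cabsX x k : cabs (x ^+ k) = cabs x ^+ k.
Proof. by elim: k => [|k IHk]; rewrite ?cabs1 // !exprS cabsM IHk. Qed.

Lemma cabs_real (r : R) : cabs r%:C = `|r|.
Proof. by rewrite /= expr0n addr0 sqrtr_sqr. Qed.

Lemma cabs_le_ReIm x : cabs x <= `|complex.Re x| + `|complex.Im x|.
Proof.
case: x => a b /=.
rewrite -[leRHS]ger0_norm ?addr_ge0 // -sqrtr_sqr ler_sqrt ?sqr_ge0 //.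
rewrite sqrrD !real_normK ?num_real //; have := normr_ge0 a; have := normr_ge0 b; nra.
Qed.

Lemma Re_le_cabs x : `|complex.Re x| <= cabs x.
Proof.
by case: x => a b /=; rewrite -sqrtr_sqr ler_sqrt ?addr_ge0 ?sqr_ge0 // lerDl sqr_ge0.
Qed.

Lemma Im_le_cabs x : `|complex.Im x| <= cabs x.
Proof.
by case: x => a b /=; rewrite -sqrtr_sqr ler_sqrt ?addr_ge0 ?sqr_ge0 // lerDr sqr_ge0.
Qed.

End ComplexModulus.

(** This norm needs no square roots and is additive over [row_mx]. It is equivalent to [enorm], with
    which it is compared only at the end. *)
Definition l1norm (R : realType) (n : nat) (z : 'rV[R[i]]_n) : R :=
  \sum_(k < n) cabs (z 0 k).

Section VectorNorm.
Variable R : realType.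
Implicit Types (n m : nat).

Lemma l1norm_ge0 n (z : 'rV[R[i]]_n) : 0 <= l1norm z.
Proof. by apply: sumr_ge0 => k _; exact: cabs_ge0. Qed.

Lemma l1norm0 n : l1norm (0 : 'rV[R[i]]_n) = 0.
Proof. by rewrite /l1norm big1 // => k _; rewrite mxE cabs0. Qed.

Lemma l1norm_eq0 n (z : 'rV[R[i]]_n) : (l1norm z == 0) = (z == 0).
Proof.
apply/eqP/eqP => [z0|->]; last exact: l1norm0.
apply/rowP => k; rewrite mxE; apply/eqP; rewrite -cabs_eq0; apply/eqP.
by move: k (erefl true); apply: psumr_eq0P z0 => k _; exact: cabs_ge0.
Qed.

Lemma l1norm_gt0 n (z : 'rV[R[i]]_n) : (0 < l1norm z) = (z != 0).
Proof. by rewrite lt_neqAle l1norm_ge0 andbT eq_sym l1norm_eq0. Qed.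

Lemma l1normD n (x y : 'rV[R[i]]_n) : l1norm (x + y) <= l1norm x + l1norm y.
Proof. by rewrite /l1norm -big_split; apply: ler_sum => k _; rewrite mxE cabsD. Qed.

Lemma l1normZ n c (x : 'rV[R[i]]_n) : l1norm (c *: x) = cabs c * l1norm x.
Proof. by rewrite /l1norm big_distrr; apply: eq_bigr => k _; rewrite mxE cabsM. Qed.

Lemma l1normN n (x : 'rV[R[i]]_n) : l1norm (- x) = l1norm x.
Proof. by rewrite -scaleN1r l1normZ cabsN cabs1 mul1r. Qed.

Lemma l1normBC n (x y : 'rV[R[i]]_n) : l1norm (x - y) = l1norm (y - x).
Proof. by rewrite -opprB l1normN. Qed.

Lemma l1normB n (x y : 'rV[R[i]]_n) : l1norm (x - y) <= l1norm x + l1norm y.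
Proof. by rewrite -(l1normN y) l1normD. Qed.

Lemma l1norm_tri n (y x z : 'rV[R[i]]_n) : l1norm (x - z) <= l1norm (x - y) + l1norm (y - z).
Proof. by rewrite -[x - z](subrKA y) l1normD. Qed.

Lemma l1norm_le_dist n (x y : 'rV[R[i]]_n) : l1norm x <= l1norm y + l1norm (x - y).
Proof. by rewrite -{1}(subrK y x) addrC l1normD. Qed.

Lemma cabs_le_l1norm n (z : 'rV[R[i]]_n) k : cabs (z 0 k) <= l1norm z.
Proof.
by rewrite /l1norm (bigD1 k) //= lerDl; apply: sumr_ge0 => i _; exact: cabs_ge0.
Qed.

Lemma l1norm_le_const n (z : 'rV[R[i]]_n) e :
  (forall k, cabs (z 0 k) <= e) -> l1norm z <= n%:R * e.
Proof.
move=> le_e; rewrite -[n in n%:R]card_ord mulr_natl -sumr_const.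
by apply: ler_sum => k _.
Qed.

Definition mxnorm n m (V : 'M[R[i]]_(n, m)) : R := \sum_i l1norm (row i V).

Lemma mxnorm_ge0 n m (V : 'M[R[i]]_(n, m)) : 0 <= mxnorm V.
Proof. by apply: sumr_ge0 => i _; exact: l1norm_ge0. Qed.

Lemma l1norm_mulmx n m (z : 'rV[R[i]]_n) (V : 'M[R[i]]_(n, m)) :
  l1norm (z *m V) <= l1norm z * mxnorm V.
Proof.
rewrite mulmx_sum_row /mxnorm big_distrr /=.
elim/big_ind2: _ => [|x1 y1 x2 y2 le1 le2|i _]; first by rewrite l1norm0.
  exact: le_trans (l1normD _ _) (lerD le1 le2).
by rewrite l1normZ ler_wpM2r ?l1norm_ge0 ?cabs_le_l1norm.
Qed.

Lemma l1norm_row_mx n m (x : 'rV[R[i]]_n) (y : 'rV[R[i]]_m) :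
  l1norm (row_mx x y) = l1norm x + l1norm y.
Proof.
rewrite /l1norm big_split_ord /=; congr (_ + _); apply: eq_bigr => k _.
  by rewrite row_mxEl.
by rewrite row_mxEr.
Qed.

Lemma l1norm_scalar (c : R[i]) : l1norm (c%:M : 'M[R[i]]_1) = cabs c.
Proof. by rewrite /l1norm big_ord1 mxE eqxx. Qed.

(** Real and imaginary parts carry the sequence into a compact box of dimension 2n. The indices
    [phi k] need not increase: [k <= phi k], together with an explicit rate, is what the later
    limits use. *)
Lemma bolzano_weierstrass n (u : nat -> 'rV[R[i]]_n) (B : R) :
  (forall k, l1norm (u k) <= B) ->
  exists p (phi : nat -> nat), forall k, (k <= phi k)%N /\ l1norm (u (phi k) - p) < k.+1%:R^-1.
Proof.
move=> uB.
pose re (z : 'rV[R[i]]_n) : 'rV[R]_(n + n) :=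
  row_mx (\row_j complex.Re (z 0 j)) (\row_j complex.Im (z 0 j)).
have reB k j : `|re (u k) ord0 j| <= B.
  rewrite /re -(splitK j); case: (fintype.split j) => i /=; rewrite ?row_mxEl ?row_mxEr mxE.
    by apply: le_trans (uB k); apply: le_trans (cabs_le_l1norm _ i); exact: Re_le_cabs.
  by apply: le_trans (uB k); apply: le_trans (cabs_le_l1norm _ i); exact: Im_le_cabs.
pose K : set 'rV[R]_(n + n) := [set v | forall i, [set` `[- B, B]] (v ord0 i)].
have cK : compact K.
  exact: (@rV_compact R (n + n) (fun=> [set` `[- B, B]]) (fun=> @segment_compact R _ _)).
pose F : set_system 'rV[R]_(n + n) := (fun k => re (u k)) @ \oo.
have FK : F K.
  exists 0%N => // k _ i; rewrite /= in_itv /=; have := reB k i; rewrite ler_norml.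
  by [].
have [v [_ clv]] := cK F _ FK.
pose p : 'rV[R[i]]_n := \row_j (v 0 (lshift n j) +i* v 0 (rshift n j)).
have near_p k e : 0 < e -> exists l, (k <= l)%N /\ l1norm (u l - p) <= n%:R * (e + e).
  move=> e0.
  have Fk : F ((fun k => re (u k)) @` [set l | (k <= l)%N]).
    by exists k => // l /= kl; exists l.
  have [w [[l kl <-] [_ bl]]] := clv _ _ Fk (nbhsx_ballx v e e0).
  exists l; split=> //; apply: l1norm_le_const => j.
  have lt_e i : `|re (u l) 0 i - v 0 i| <= e.
    by have := bl ord0 i; rewrite /ball /= => /ltW; rewrite distrC.
  apply: le_trans (cabs_le_ReIm _) _; rewrite !mxE; apply: lerD.
    have := lt_e (lshift n j); rewrite row_mxEl mxE.
    by case: (u l 0 j).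
  have := lt_e (rshift n j); rewrite row_mxEr mxE.
  by case: (u l 0 j).
have near_p' k : exists l, (k <= l)%N /\ l1norm (u l - p) < k.+1%:R^-1.
  have k0 : (0 : R) < k.+1%:R^-1 by rewrite invr_gt0 ltr0n.
  pose e : R := k.+1%:R^-1 / (n.+1%:R * 4).
  have e0 : 0 < e by rewrite divr_gt0 // mulr_gt0 // ltr0n.
  have [l [kl le_l]] := near_p k e e0; exists l; split=> //.
  apply: le_lt_trans le_l _.
  have -> : k.+1%:R^-1 = n.+1%:R * 4 * e by rewrite /e mulrC divfK // gt_eqF // mulr_gt0 ?ltr0n.
  rewrite -[n.+1]addn1 natrD; have : (0 : R) <= n%:R by rewrite ler0n.
  nra.
have [phi phiP] := boolp.choice near_p'.
by exists p, phi.
Qed.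

End VectorNorm.

Definition dst (R : realType) (n : nat) (x y : 'rV[R[i]]_n) : R := l1norm (x - y).

(* [lra] compares atoms up to conversion, which is prohibitive on vectors:
   the norms are abstracted first. *)
Ltac norm_lra :=
  repeat match goal with
  | H : is_true (Order.le _ _) |- _ => revert H
  | H : is_true (Order.lt _ _) |- _ => revert H
  end;
  repeat match goal with
  | |- context C [@l1norm ?R ?n (Algebra.add ?x (Algebra.opp ?y))] =>
      let G := context C [@dst R n x y] in change G
  end;
  repeat match goal with
  | |- context [@dst ?R ?n ?x ?y] => generalize (@dst R n x y); intro
  end;
  repeat match goal with
  | |- context [@l1norm ?R ?n ?x] => generalize (@l1norm R n x); intro
  end;
  intros; lra.

(** * Polynomial maps: Taylor expansion and local surjectivity *)

Lemma sum_remainder (C : comRingType) (a1 a2 b1 b2 d1 d2 : C) :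
  a1 + a2 - (b1 + b2) - (d1 + d2) = (a1 - b1 - d1) + (a2 - b2 - d2).
Proof. ring. Qed.

Lemma product_increment (C : comRingType) (a1 a2 b1 b2 : C) :
  a1 * a2 - b1 * b2 = (a1 - b1) * (a2 - b2) + (b1 * (a2 - b2) + b2 * (a1 - b1)).
Proof. ring. Qed.

Lemma product_remainder (C : comRingType) (a1 a2 b1 b2 d1 d2 : C) :
  a1 * a2 - b1 * b2 - (b2 * d1 + b1 * d2) =
  (a1 - b1) * (a2 - b2) + (b1 * (a2 - b2 - d2) + b2 * (a1 - b1 - d1)).
Proof. ring. Qed.

Lemma leibniz_term (C : comRingType) (u1 u2 b1 b2 c : C) :
  (u1 * b2 + b1 * u2) * c = b2 * (u1 * c) + b1 * (u2 * c).
Proof. ring. Qed.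

Section Taylor.
Variables (R : realType) (n : nat).
Implicit Types (p q : mpoly n R[i]) (x z : 'rV[R[i]]_n).

Definition mdiff p x (z : 'rV[R[i]]_n) : R[i] :=
  \sum_(i < n) meval (x 0) (mderiv i p) * z 0 i.

(** First-order Taylor expansion with quadratic remainder on the unit ball. The Lipschitz bound
    makes the property stable under products, where the product of two increments must be
    quadratic. *)
Definition differentiable_mpoly p x := exists (C M : R), [/\ 0 <= C, 0 <= M &
  forall z, l1norm z <= 1 ->
    cabs (meval ((x + z) 0) p - meval (x 0) p) <= M * l1norm z /\
    cabs (meval ((x + z) 0) p - meval (x 0) p - mdiff p x z) <= C * l1norm z ^+ 2].

Lemma differentiable_mpolyD p q x : differentiable_mpoly p x ->
  differentiable_mpoly q x -> differentiable_mpoly (p + q) x.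
Proof.
move=> [C1 [M1 [C10 M10 H1]]] [C2 [M2 [C20 M20 H2]]].
exists (C1 + C2), (M1 + M2); split; rewrite ?addr_ge0 // => z z1.
have [Mz1 Cz1] := H1 z z1; have [Mz2 Cz2] := H2 z z1.
have -> : mdiff (p + q) x z = mdiff p x z + mdiff q x z.
  by rewrite /mdiff -big_split; apply: eq_bigr => i _; rewrite mderivD mevalD mulrDl.
rewrite !mevalD; set a1 := meval _ p in Mz1 Cz1 *; set a2 := meval _ q in Mz2 Cz2 *.
set b1 := meval _ p in Mz1 Cz1 *; set b2 := meval _ q in Mz2 Cz2 *.
split.
  have -> : a1 + a2 - (b1 + b2) = (a1 - b1) + (a2 - b2) by rewrite opprD addrACA.
  by apply: le_trans (cabsD _ _) _; rewrite mulrDl lerD.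
have -> : a1 + a2 - (b1 + b2) - (mdiff p x z + mdiff q x z) =
  (a1 - b1 - mdiff p x z) + (a2 - b2 - mdiff q x z).
  by rewrite sum_remainder.
by apply: le_trans (cabsD _ _) _; rewrite mulrDl lerD.
Qed.

Lemma differentiable_mpolyM p q x : differentiable_mpoly p x ->
  differentiable_mpoly q x -> differentiable_mpoly (p * q) x.
Proof.
move=> [C1 [M1 [C10 M10 H1]]] [C2 [M2 [C20 M20 H2]]].
set b1 := meval (x 0) p; set b2 := meval (x 0) q.
exists (M1 * M2 + (cabs b1 * C2 + cabs b2 * C1)),
  (M1 * M2 + (cabs b1 * M2 + cabs b2 * M1)).
split; rewrite ?addr_ge0 ?mulr_ge0 ?cabs_ge0 // => z z1.
have [Mz1 Cz1] := H1 z z1; have [Mz2 Cz2] := H2 z z1.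
have -> : mdiff (p * q) x z = b2 * mdiff p x z + b1 * mdiff q x z.
  rewrite /mdiff !big_distrr -big_split; apply: eq_bigr => i _ /=.
  by rewrite mderivM mevalD !mevalM -/b1 -/b2 leibniz_term.
rewrite !mevalM -/b1 -/b2; set a1 := meval _ p in Mz1 Cz1 *.
set a2 := meval _ q in Mz2 Cz2 *.
have z0 := l1norm_ge0 z.
have M12 : cabs ((a1 - b1) * (a2 - b2)) <= (M1 * M2) * l1norm z ^+ 2.
  rewrite cabsM; apply: le_trans (ler_pM _ _ Mz1 Mz2) _; rewrite ?cabs_ge0 //.
  by rewrite mulrACA -expr2.
have bd u1 u2 B1 B2 N : cabs u1 <= B1 * N -> cabs u2 <= B2 * N ->
    cabs (b1 * u2 + b2 * u1) <= (cabs b1 * B2 + cabs b2 * B1) * N.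
  move=> le1 le2; apply: le_trans (cabsD _ _) _; rewrite !cabsM mulrDl -!mulrA.
  by apply: lerD; apply: ler_wpM2l; rewrite ?cabs_ge0.
split.
  rewrite product_increment.
  apply: le_trans (cabsD _ _) _; rewrite [leRHS]mulrDl; apply: lerD; last exact: bd.
  apply: le_trans M12 _; rewrite ler_wpM2l ?mulr_ge0 //.
  by rewrite expr2 ler_piMr.
rewrite product_remainder.
by apply: le_trans (cabsD _ _) _; rewrite [leRHS]mulrDl; apply: lerD => //; exact: bd.
Qed.

Lemma differentiable_mpolyC c x : differentiable_mpoly (mpolyC n c) x.
Proof.
exists 0, 0; split=> // z _; rewrite !mevalC !mul0r subrr cabs0; split=> //.
rewrite /mdiff big1 ?subr0 ?cabs0 // => i _.
by rewrite mderivC meval0 mul0r.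
Qed.

Lemma differentiable_mpolyX i x : differentiable_mpoly (mpolyX R[i] (mnm1 i)) x.
Proof.
exists 0, 1; split=> // z _; rewrite !mevalXU mxE addrAC subrr add0r mul1r mul0r.
split; first exact: cabs_le_l1norm.
have -> : mdiff (mpolyX R[i] (mnm1 i)) x z = z 0 i.
  rewrite /mdiff (bigD1 i) //= mderivX mnm1E eqxx scale1r.
  have -> : mnm_sub (mnm1 i) (mnm1 i) = @mnm0 n.
    by apply/mnmP => j; rewrite mnmBE subnn mnm0E.
  rewrite mpolyX0 meval1 mul1r.
  rewrite big1 ?addr0 // => j nj.
  by rewrite mderivX mnm1E eq_sym (negPf nj) scale0r meval0 mul0r.
by rewrite subrr cabs0.
Qed.

Lemma mpoly_differentiable p x : differentiable_mpoly p x.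
Proof.
have dE k i : differentiable_mpoly (mpolyX R[i] (mnm1 i) ^+ k) x.
  elim: k => [|k IHk]; first by rewrite expr0; exact: (differentiable_mpolyC 1).
  rewrite exprS; apply: differentiable_mpolyM; last exact: IHk.
  exact: differentiable_mpolyX.
rewrite [p]mpolyE; elim/big_ind: _ => [|q1 q2|m _].
- by rewrite -(mpolyC0 n R[i]); exact: differentiable_mpolyC.
- exact: differentiable_mpolyD.
rewrite -mul_mpolyC; apply: differentiable_mpolyM; first exact: differentiable_mpolyC.
rewrite mpolyXE_id; elim/big_ind: _ => [|q1 q2|i _]; last exact: dE.
  exact: (differentiable_mpolyC 1).
exact: differentiable_mpolyM.
Qed.

Lemma meval_continuous p x (e : R) : 0 < e ->
  exists2 d, 0 < d & forall y, l1norm (y - x) < d ->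
    cabs (meval ((y : 'rV_n) 0) p - meval (x 0) p) < e.
Proof.
move=> e0; have [C [M [_ M0 H]]] := mpoly_differentiable p x.
exists (Num.min 1 (e / (M + 1))).
  by rewrite lt_min ltr01 divr_gt0 // ltr_wpDl.
move=> y; rewrite lt_min => /andP[y1 ye].
have [le_M _] := H _ (ltW y1); move: le_M; rewrite subrKC => /le_lt_trans; apply.
by move: ye; rewrite ltr_pdivlMr ?ltr_wpDl //; have := l1norm_ge0 (y - x); nra.
Qed.

End Taylor.

(** The hypotheses express in terms of the norm that [S] is bounded and closed and that [phi] is
    lower semicontinuous; a minimising sequence then clusters at a minimum. *)
Lemma compact_minimum (R : realType) (n : nat) (S : set 'rV[R[i]]_n)
    (phi : 'rV[R[i]]_n -> R) (B : R) :
  (exists z, S z) -> (forall z, S z -> l1norm z <= B) ->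
  (forall p, (forall e, 0 < e -> exists2 z, S z & l1norm (z - p) < e) -> S p) ->
  (forall z, 0 <= phi z) ->
  (forall p e, 0 < e -> exists2 d, 0 < d & forall z, l1norm (z - p) < d -> phi p < phi z + e) ->
  exists2 z, S z & forall z', S z' -> phi z <= phi z'.
Proof.
move=> [z0 Sz0] SB Scl phi0 phic.
pose E := phi @` S.
have Ene : E !=set0 by exists (phi z0), z0.
have Elb : has_inf E by split=> //; exists 0 => _ [z _ <-].
have min_seq k : exists z, S z /\ phi z < inf E + k.+1%:R^-1.
  have k0 : (0 : R) < k.+1%:R^-1 by rewrite invr_gt0 ltr0n.
  by have [_ [z Sz <-] lt_z] := inf_adherent k0 Elb; exists z.
have [u uP] := boolp.choice min_seq.
have [p [f fP]] := bolzano_weierstrass (fun k => SB _ (uP k).1).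
have near_p (e : R) : 0 < e -> exists k, l1norm (u (f k) - p) < e /\ phi (u (f k)) < inf E + e.
  move=> e0; have [k ke] := ltr_add_invr e0.
  rewrite add0r in ke; exists k; split; first exact: lt_trans (fP k).2 ke.
  apply: lt_trans (uP _).2 _; rewrite ltrD2l; apply: le_lt_trans ke.
  by rewrite lef_pV2 ?posrE ?ltr0n // ler_nat ltnS (fP k).1.
exists p.
  by apply: Scl => e /near_p[k [lt_e _]]; exists (u (f k)) => //; exact: (uP _).1.
move=> z' Sz'; apply: (@le_trans _ _ (inf E)); last first.
  by apply: ge_inf; [exact: Elb.2|exists z'].
apply/ler_addgt0Pr => e e0; have e20 : 0 < e / 2 by rewrite divr_gt0.
have [d d0 dP] := phic p _ e20.
have [k [lt_d lt_e]] := near_p (Num.min d (e / 2)) ltac:(by rewrite lt_min d0 e20).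
rewrite lt_min in lt_d; case/andP: lt_d => lt_d _.
have := dP _ lt_d; have : Num.min d (e / 2) <= e / 2 by rewrite ge_min lexx orbT.
by lra.
Qed.

Section PolynomialMaps.
Variables (R : realType) (n : nat).

Definition evp k (F : 'I_k -> mpoly n R[i]) (x : 'rV[R[i]]_n) : 'rV[R[i]]_k :=
  \row_j meval (x 0) (F j).

Definition jacobian k (F : 'I_k -> mpoly n R[i]) : 'M[mpoly n R[i]]_(n, k) :=
  \matrix_(i, j) mderiv i (F j).

Definition jac k (F : 'I_k -> mpoly n R[i]) (x : 'rV[R[i]]_n) : 'M[R[i]]_(n, k) :=
  map_mx (meval (x 0)) (jacobian F).

Lemma evp_taylor k (F : 'I_k -> mpoly n R[i]) x : exists2 C : R, 0 <= C &
  forall z, l1norm z <= 1 -> l1norm (evp F (x + z) - evp F x - z *m jac F x) <= C * l1norm z ^+ 2.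
Proof.
have /boolp.choice[c cP] (j : 'I_k) : exists c : R, 0 <= c /\ forall z, l1norm z <= 1 ->
    cabs (meval ((x + z) 0) (F j) - meval (x 0) (F j) - mdiff (F j) x z) <= c * l1norm z ^+ 2.
  have [C [M [C0 M0 H]]] := mpoly_differentiable (F j) x.
  by exists C; split=> // z /H[].
exists (\sum_j c j) => [|z z1]; first by apply: sumr_ge0 => j _; exact: (cP j).1.
rewrite big_distrl /=; apply: ler_sum => j _; apply: le_trans ((cP j).2 _ z1).
rewrite !mxE /mdiff le_eqVlt; apply/orP; left; apply/eqP; congr (cabs (_ - _)).
by apply: eq_bigr => i _; rewrite !mxE mulrC.
Qed.

Lemma evp_continuous k (F : 'I_k -> mpoly n R[i]) x (e : R) : 0 < e ->
  exists2 d, 0 < d & forall y, l1norm (y - x) < d -> l1norm (evp F y - evp F x) < e.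
Proof.
move=> e0; pose C1 := mxnorm (jac F x).
have C10 : 0 <= C1 := mxnorm_ge0 _.
have [C C0 H] := evp_taylor F x.
have CC1 : 0 < C + C1 + 1 by rewrite ltr_wpDl ?addr_ge0.
exists (Num.min 1 (e / (C + C1 + 1))); first by rewrite lt_min ltr01 divr_gt0.
move=> y; rewrite lt_min => /andP[y1]; rewrite ltr_pdivlMr // => ye.
have := H _ (ltW y1); rewrite subrKC => le_C.
have := l1norm_mulmx (y - x) (jac F x); rewrite -/C1 => le_C1.
have := l1norm_le_dist (evp F y - evp F x) ((y - x) *m jac F x).
have t0 := l1norm_ge0 (y - x).
have : C * l1norm (y - x) ^+ 2 <= C * l1norm (y - x).
  by rewrite ler_wpM2l // expr2 ler_piMr // ltW.
by move: le_C1 le_C ye; lra.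
Qed.

Lemma l1norm_tril k (a b c : 'rV[R[i]]_k) : l1norm (a - c) <= l1norm (b - c) + l1norm (b - a).
Proof. by rewrite [leRHS]addrC [l1norm (b - a)]l1normBC l1norm_tri. Qed.

Lemma closed_ball_closed (z0 p : 'rV[R[i]]_n) (r : R) :
  (forall e, 0 < e -> exists2 z, l1norm (z - z0) <= r & l1norm (z - p) < e) -> l1norm (p - z0) <= r.
Proof.
move=> H; apply/ler_addgt0Pr => e /H[z zr ze].
by have := l1norm_tril p z z0; lra.
Qed.

(* Where the Jacobian is invertible, [|F - y|] has no positive local minimum. *)
Lemma local_surjectivity (F : 'I_n -> mpoly n R[i]) z0 (r : R) :
  \det (jac F z0) != 0 -> 0 < r ->
  exists2 rho, 0 < rho & forall y, l1norm (y - evp F z0) < rho ->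
    exists2 z, l1norm (z - z0) < r & evp F z = y.
Proof.
move=> det0 r0.
have detE z : \det (jac F z) = meval (z 0) (\det (jacobian F)).
  by rewrite /jac det_map_mx.
have [r2 r20 r2P] : exists2 r2, 0 < r2 & forall z, l1norm (z - z0) < r2 -> \det (jac F z) != 0.
  have c0 : 0 < cabs (\det (jac F z0)) by rewrite cabs_gt0.
  have [d d0 dP] := meval_continuous (\det (jacobian F)) z0 c0.
  exists d; [exact: d0|move=> z /dP]; rewrite -!detE; apply: contraTneq => ->.
  by rewrite sub0r cabsN ltxx.
pose A := jac F z0; pose ka := mxnorm (invmx A) + 1.
have ka0 : 0 < ka by rewrite ltr_wpDl // mxnorm_ge0.
have le_ka z : l1norm z <= ka * l1norm (z *m A).
  have := l1norm_mulmx (z *m A) (invmx A); rewrite mulmxK ?unitmxE ?unitfE //.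
  rewrite /ka; have := l1norm_ge0 (z *m A); nra.
have [C C0 CP] := evp_taylor F z0.
pose r1 := Num.min (Num.min (r / 2) (r2 / 2)) (Num.min 1 ((2 * ka * (C + 1))^-1)).
have kaC : 0 < 2 * ka * (C + 1) by rewrite !mulr_gt0 // ltr_wpDl.
have r10 : 0 < r1 by rewrite !lt_min ltr01 !divr_gt0 // invr_gt0.
have [r1r r1r2 r11 r1C] : [/\ r1 < r, r1 < r2, r1 <= 1 & r1 * (2 * ka * (C + 1)) <= 1].
  split.
  - by apply: (@le_lt_trans _ _ (r / 2)); [rewrite !ge_min lexx|lra].
  - by apply: (@le_lt_trans _ _ (r2 / 2)); [rewrite !ge_min lexx orbT|lra].
  - by rewrite !ge_min lexx !orbT.
  - by rewrite -ler_pdivlMr // mul1r !ge_min lexx !orbT.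
(* For small [z - z0] the quadratic Taylor remainder absorbs at most half of the linear term, which
   is bounded below through the inverse of the Jacobian. *)
have expand z : l1norm (z - z0) <= r1 -> l1norm (z - z0) <= 2 * ka * l1norm (evp F z - evp F z0).
  move=> zr; have := CP (z - z0) (le_trans zr r11); rewrite subrKC => leC.
  have := le_ka (z - z0); rewrite -/A in leC *.
  have := l1norm_le_dist ((z - z0) *m A) (evp F z - evp F z0).
  rewrite [l1norm (_ - (evp F z - _))]l1normBC => le1 le2.
  have z00 := l1norm_ge0 (z - z0).
  have : ka * (C * l1norm (z - z0) ^+ 2) <= l1norm (z - z0) / 2.
    have -> : ka * (C * l1norm (z - z0) ^+ 2) = (ka * C * l1norm (z - z0)) * l1norm (z - z0) by ring.
    rewrite [leRHS]mulrC; apply: ler_wpM2r => //.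
    have : l1norm (z - z0) * (2 * ka * (C + 1)) <= 1.
      by apply: le_trans r1C; apply: ler_wpM2r => //; exact: ltW.
    by have := mulr_ge0 z00 (ltW ka0); lra.
  nra.
(* At a minimum [z] of |F - y| on the closed ball, F(z) is within twice this radius of F(z0); by
   [expand], [z] then lies strictly inside the ball. *)
exists (r1 / (4 * ka)); first by rewrite divr_gt0 ?mulr_gt0.
move=> y; rewrite ltr_pdivlMr ?mulr_gt0 // => y_near.
have [|||||z zr zmin] := @compact_minimum _ _ (fun z => l1norm (z - z0) <= r1)
    (fun z => l1norm (evp F z - y)) (l1norm z0 + r1).
- by exists z0; rewrite subrr l1norm0 ltW.
- by move=> z zr; have := l1norm_le_dist z z0; lra.
- by move=> p; exact: closed_ball_closed.
- by move=> z; exact: l1norm_ge0.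
- move=> p e e0; have [d d0 dP] := evp_continuous F p e0; exists d => // z /dP.
  by have := l1norm_tril (evp F p) (evp F z) y; norm_lra.
have zlt : l1norm (z - z0) < r1.
  have := zmin z0 ltac:(by rewrite subrr l1norm0 ltW) => le_z.
  have := expand _ zr; have := l1norm_tri y (evp F z) (evp F z0).
  rewrite (l1normBC (evp F z0)) in le_z; nra.
exists z; first exact: lt_trans zlt r1r.
apply/eqP; rewrite -subr_eq0; apply: contraT => e0; set e := _ - y in e0.
have detz := r2P _ (lt_trans zlt r1r2).
(* The Newton direction: moving from [z] by [s h] changes the error [e] into (1 - s) e plus a term
   quadratic in [s], which contradicts minimality when [s] is small. *)
pose h := - e *m invmx (jac F z).
have hE : h *m jac F z = - e by rewrite /h mulmxKV ?unitmxE ?unitfE.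
have [C' C'0 C'P] := evp_taylor F z.
have ne0 : 0 < l1norm e by rewrite l1norm_gt0.
pose h0 := l1norm h + 1; have h00 : 0 < h0 by rewrite ltr_wpDl // l1norm_ge0.
have C'h : 0 < (C' + 1) * h0 ^+ 2 by rewrite mulr_gt0 ?exprn_gt0 // ltr_wpDl.
have zgap : 0 < r1 - l1norm (z - z0) by rewrite subr_gt0.
(* These bounds keep [s <= 1], the step within the range of the Taylor estimate, the new point
   inside the ball, and the quadratic remainder below s |e|. *)
pose s := Num.min (Num.min 1 h0^-1)
  (Num.min ((r1 - l1norm (z - z0)) / h0) (l1norm e / ((C' + 1) * h0 ^+ 2))).
have s0 : 0 < s by rewrite !lt_min ltr01 invr_gt0 h00 !divr_gt0.
have [s1 sh sr se] : [/\ s <= 1, s * h0 <= 1, s * h0 <= r1 - l1norm (z - z0)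
    & s * ((C' + 1) * h0 ^+ 2) <= l1norm e].
  split; rewrite -?ler_pdivlMr ?mul1r //; first by rewrite !ge_min lexx.
  - by rewrite !ge_min lexx orbT.
  - by rewrite !ge_min lexx !orbT.
  - by rewrite !ge_min lexx !orbT.
have nsh : l1norm (s%:C *: h) <= s * h0.
  by rewrite l1normZ cabs_real ger0_norm ?(ltW s0) // ler_wpM2l ?(ltW s0) // lerDl.
have /zmin : l1norm (z + s%:C *: h - z0) <= r1.
  by rewrite addrAC; apply: le_trans (l1normD _ _) _; lra.
rewrite leNgt => /negP[].
have := C'P _ (le_trans nsh sh).
rewrite -scalemxAl hE.
set w := evp F (z + _); set rm := (X in l1norm X <= _) => le_rm.
have -> : w - y = (1 - s)%:C *: e + rm.
  have -> : (1 - s)%:C = 1 - s%:C by rewrite rmorphB.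
  by apply/rowP => j; rewrite /rm /e !mxE; ring.
apply: le_lt_trans (l1normD _ _) _; rewrite l1normZ cabs_real ger0_norm ?subr_ge0 //.
have : l1norm (s%:C *: h) ^+ 2 <= (s * h0) ^+ 2.
  by rewrite ler_sqr ?nnegrE ?l1norm_ge0 // mulr_ge0 ?ltW.
rewrite exprMn => le2.
have : C' * l1norm (s%:C *: h) ^+ 2 < s * l1norm e.
  apply: (@le_lt_trans _ _ (C' * (s ^+ 2 * h0 ^+ 2))); first exact: ler_wpM2l.
  apply: (@lt_le_trans _ _ (s * (s * ((C' + 1) * h0 ^+ 2)))); last by rewrite ler_wpM2l ?(ltW s0).
  have -> : s * (s * ((C' + 1) * h0 ^+ 2)) = C' * (s ^+ 2 * h0 ^+ 2) + s ^+ 2 * h0 ^+ 2 by ring.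
  by rewrite ltrDl mulr_gt0 ?exprn_gt0.
lra.
Qed.

End PolynomialMaps.

(** * Lifting a segment through a polynomial map *)

Lemma mpoly_on_line (K : fieldType) (n : nat) (D : mpoly n K) (y v : 'rV[K]_n) :
  exists q : {poly K}, forall s, q.[s] = meval ((y + s *: v) 0) D.
Proof.
exists (\sum_(m <- msupp D)
  mcoeff m D *: \prod_i ((y 0 i)%:P + v 0 i *: 'X) ^+ m i) => s.
rewrite mevalE horner_sum; apply: eq_bigr => m _.
rewrite hornerZ horner_prod; congr (_ * _); apply: eq_bigr => i _.
by rewrite horner_exp !hornerE !mxE [s * _]mulrC.
Qed.

Lemma poly_avoid (K : fieldType) (p : {poly K}) (u : nat -> K) :
  p != 0 -> injective u -> exists k, p.[u k] != 0.
Proof.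
move=> p0 u_inj; apply: contrapT => nex.
have all_root k : root p (u k).
  by rewrite /root; apply: contraT => pk; case: nex; exists k.
have := @max_poly_roots _ p (map u (iota 0 (size p))) p0.
rewrite map_inj_uniq ?iota_uniq // size_map size_iota ltnn => H.
by have // : false; apply: H => //; apply/allP => _ /mapP[k _ ->].
Qed.

(** * Avoiding zero sets of polynomials; induction along a real interval *)

Section Avoidance.
Variable R : realType.

Lemma poly_avoid_small (p : {poly R[i]}) (e : R) : p != 0 -> 0 < e ->
  exists2 c, cabs c < e & p.[c] != 0.
Proof.
move=> p0 e0; pose u k : R[i] := (e / k.+2%:R)%:C.
have u_inj : injective u.
  move=> j k [] /(mulfI (lt0r_neq0 e0)) /invr_inj /eqP.
  by rewrite eqr_nat => /eqP [].
have [k pk] := poly_avoid p0 u_inj; exists (u k) => //.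
rewrite cabs_real ger0_norm ?divr_ge0 ?ler0n ?(ltW e0) //.
by rewrite ltr_pdivrMr ?ltr0n // ltr_pMr // ltr1n.
Qed.

(** The directions 1 + i e / (k + 2) span distinct real lines through 0. As p(0) is not 0, a root on
    each of these lines would give infinitely many distinct roots. *)
Lemma poly_avoid_ray (p : {poly R[i]}) (e : R) : p.[0] != 0 -> 0 < e ->
  exists2 c, cabs (c - 1) < e & forall s : R, p.[s%:C * c] != 0.
Proof.
move=> p0 e0; pose u k : R[i] := 1 +i* (e / k.+2%:R).
have [[k pk]|nex] := pselect (exists k, forall s : R, p.[s%:C * u k] != 0).
  exists (u k) => //; have -> : u k - 1 = 0 +i* (e / k.+2%:R).
    rewrite -[LHS]/((1 - 1) +i* (e / k.+2%:R - 0)).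
    by rewrite subrr subr0.
  rewrite /= expr0n add0r sqrtr_sqr ger0_norm ?divr_ge0 ?ler0n ?(ltW e0) //.
  by rewrite ltr_pdivrMr ?ltr0n // ltr_pMr // ltr1n.
have /boolp.choice[s sP] k : exists s : R, p.[s%:C * u k] == 0.
  apply: contrapT => ns; apply: nex; exists k => s.
  by apply/negP => ps; apply: ns; exists s.
have s0 k : s k != 0.
  by apply: contraNneq p0 => sk0; have := sP k; rewrite sk0 mul0r.
have pn0 : p != 0 by apply: contraNneq p0 => ->; rewrite horner0.
have [j k eq_jk|k] := @poly_avoid _ p (fun k => (s k)%:C * u k) pn0.
  have uE i : (s i)%:C * u i = s i +i* (s i * (e / i.+2%:R)).
    rewrite -[LHS]/((s i * 1 - 0 * (e / i.+2%:R)) +i* (s i * (e / i.+2%:R) + 0 * 1)).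
    by rewrite !mul0r subr0 mulr1 addr0.
  move: eq_jk; rewrite !uE => -[-> /(mulfI (s0 k)) /(mulfI (lt0r_neq0 e0))].
  by move=> /invr_inj /eqP; rewrite eqr_nat => /eqP [].
by rewrite sP.
Qed.

Lemma mpoly_avoid n (D : mpoly n R[i]) (y : 'rV[R[i]]_n) (e : R) : D != 0 -> 0 < e ->
  exists2 y', l1norm (y' - y) < e & meval ((y' : 'rV_n) 0) D != 0.
Proof.
move=> D0 e0; have [v Dv] := mpoly_neq0_meval D0.
pose v' : 'rV_n := \row_j v j.
have [q qE] := mpoly_on_line D y (v' - y).
have q0 : q != 0.
  apply: contraNneq Dv => q0; have := qE 1; rewrite q0 horner0 scale1r subrKC => Dv.
  rewrite Dv; apply/eqP/esym; rewrite -[RHS]/(meval v D).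
  by apply: meval_eq => i; rewrite mxE.
have c0 : 0 < l1norm (v' - y) + 1 by rewrite ltr_wpDl ?l1norm_ge0.
have [c lt_c qc] := poly_avoid_small q0 (divr_gt0 e0 c0).
exists (y + c *: (v' - y)); last by rewrite -qE.
rewrite addrAC subrr add0r l1normZ; move: lt_c; rewrite ltr_pdivlMr //.
by have := cabs_ge0 c; lra.
Qed.

(** Connectedness of [0, b]: the supremum of the points satisfying [E] satisfies it by closedness,
    and could be exceeded by openness to the right if it were below [b]. *)
Lemma interval_induction (E : R -> Prop) (b : R) : 0 <= b -> E 0 ->
  (forall s, 0 <= s <= b ->
    (forall e, 0 < e -> exists s', [/\ 0 <= s' <= b, E s' & `|s' - s| < e]) -> E s) ->
  (forall s, 0 <= s < b -> E s ->
    exists2 d, 0 < d & forall s', s <= s' < s + d -> E s') ->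
  E b.
Proof.
move=> b0 E0 Ecl Eop.
pose S := [set s : R | 0 <= s <= b /\ E s].
have S0 : S 0 by split=> //; rewrite lexx.
have supS : has_sup S by split; [exists 0|exists b => s [/andP[]]].
have s0 : 0 <= sup S by apply: ub_le_sup => //; exact: supS.2.
have sb : sup S <= b by apply: ge_sup; [exists 0|move=> s [/andP[]]].
have Es : E (sup S).
  apply: Ecl => [|e e0]; first by rewrite s0.
  have [s [sb' Es'] lt_s] := sup_adherent e0 supS; exists s; split=> //.
  have : s <= sup S by exact: (ub_le_sup supS.2 (conj sb' Es')).
  by move=> le_s; rewrite ler0_norm ?subr_le0 //; lra.
move: sb; rewrite le_eqVlt => /orP[/eqP<- //|lt_sb].
have [d d0 dP] := Eop _ (introT andP (conj s0 lt_sb)) Es.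
pose s' := sup S + Num.min (d / 2) (b - sup S).
have gap : 0 < Num.min (d / 2) (b - sup S) by rewrite lt_min divr_gt0 //= subr_gt0.
have le1 : Num.min (d / 2) (b - sup S) <= d / 2 by rewrite ge_min lexx.
have le2 : Num.min (d / 2) (b - sup S) <= b - sup S by rewrite ge_min lexx orbT.
have : s' <= sup S.
  apply: ub_le_sup; first exact: supS.2.
  by split; [apply/andP; split|apply: dP]; rewrite /s'; lra.
by rewrite /s'; lra.
Qed.

End Avoidance.

Lemma segment_perturbation (C : comRingType) n (a b a' : 'rV[C]_n) (s c : C) :
  a' + (s * c) *: (b - a') - (a + s *: (b - a)) =
  (1 - s) *: (a' - a) + s *: ((c - 1) *: (b - a')).
Proof. by apply/rowP => j; rewrite !mxE; ring. Qed.

Section PathLifting.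
Variables (R : realType) (n : nat).
Implicit Types (K : set 'rV[R[i]]_n) (F : 'I_n -> mpoly n R[i]).

Definition adherent_closed K :=
  forall p, (forall e, 0 < e -> exists2 z, K z & l1norm (z - p) < e) -> K p.

Definition segment k (y0 y1 : 'rV[R[i]]_k) (s : R) : 'rV[R[i]]_k :=
  y0 + s%:C *: (y1 - y0).

Definition interior_point K z :=
  exists2 r, 0 < r & forall z', l1norm (z' - z) < r -> K z'.

Lemma compact_solution K k (F : 'I_k -> mpoly n R[i]) y (B : R) : adherent_closed K ->
  (forall z, K z -> l1norm z <= B) ->
  (forall e, 0 < e -> exists2 z, K z & l1norm (evp F z - y) < e) ->
  exists2 z, K z & evp F z = y.
Proof.
move=> Kcl KB Kinf.
have [|||z Kz zmin] := @compact_minimum _ _ K (fun z => l1norm (evp F z - y)) B _ KB Kcl.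
- by have [z Kz _] := Kinf 1 ltr01; exists z.
- by move=> z; exact: l1norm_ge0.
- move=> p e e0; have [d d0 dP] := evp_continuous F p e0; exists d => // z /dP.
  by have := l1norm_tril (evp F p) (evp F z) y; norm_lra.
exists z => //; apply/eqP; rewrite -subr_eq0 -l1norm_eq0; apply: contraT => nz.
have e0 : 0 < l1norm (evp F z - y) by rewrite lt_neqAle eq_sym nz l1norm_ge0.
by have [z' Kz' lt_z'] := Kinf _ e0; have := zmin _ Kz'; norm_lra.
Qed.

(** By compactness: points of [K] that are not interior and whose images approach the segment would
    cluster at a point lying over the segment. That point has a ball contained in [K], and so do the
    nearby points of the sequence. *)
Lemma boundary_gap K F y0 y1 (B : R) : adherent_closed K ->
  (forall z, K z -> l1norm z <= B) ->
  (forall (s : R) z, 0 <= s <= 1 -> K z -> evp F z = segment y0 y1 s ->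
     interior_point K z) ->
  exists2 eta, 0 < eta & forall (s : R) z, 0 <= s <= 1 -> K z ->
    l1norm (evp F z - segment y0 y1 s) < eta -> interior_point K z.
Proof.
move=> Kcl KB Kint; apply: contrapT => nex.
have bad k : exists zs : 'rV[R[i]]_n * R, [/\ 0 <= zs.2 <= 1, K zs.1,
    l1norm (evp F zs.1 - segment y0 y1 zs.2) < k.+1%:R^-1
    & ~ interior_point K zs.1].
  apply: contrapT => nbad; apply: nex; exists k.+1%:R^-1.
    by rewrite invr_gt0 ltr0n.
  move=> s z s01 Kz lt_z; apply: contrapT => nint; apply: nbad.
  by exists (z, s).
have [u uP] := boolp.choice bad.
(* The point and the parameter of the segment are packed into one vector in order to extract a
   common cluster point. *)
have [k|p [f fP]] := @bolzano_weierstrass R _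
    (fun k => row_mx (u k).1 ((u k).2%:C%:M : 'M[R[i]]_1)) (B + 1).
  have [/andP[s0 s1] Kz _ _] := uP k.
  by rewrite l1norm_row_mx l1norm_scalar cabs_real ger0_norm // lerD ?KB.
pose z := lsubmx p; pose s := complex.Re (rsubmx p 0 0).
have near e : 0 < e -> exists k, [/\ l1norm ((u k).1 - z) < e, `|(u k).2 - s| < e
    & l1norm (evp F (u k).1 - segment y0 y1 (u k).2) < e].
  move=> e0; have [k ke] := ltr_add_invr e0; rewrite add0r in ke.
  have := lt_trans (fP k).2 ke.
  rewrite -{1}[p]hsubmxK opp_row_mx add_row_mx l1norm_row_mx -/z => lt_e.
  exists (f k); split.
  - by apply: le_lt_trans lt_e; rewrite lerDl l1norm_ge0.
  - apply: le_lt_trans lt_e.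
    apply: (@le_trans _ _ (l1norm ((u (f k)).2%:C%:M - rsubmx p : 'M[R[i]]_1)));
      last by rewrite lerDr l1norm_ge0.
    apply: le_trans (cabs_le_l1norm _ 0); apply: le_trans (Re_le_cabs _).
    by rewrite /s !mxE; case: (p _ _).
  have [_ _ lt_k _] := uP (f k); apply: lt_trans lt_k (le_lt_trans _ ke).
  by rewrite lef_pV2 ?posrE ?ltr0n // ler_nat ltnS (fP k).1.
have Kz : K z.
  apply: Kcl => e /near[k [lt_e _ _]]; exists (u k).1 => //.
  by have [] := uP k.
have s01 : 0 <= s <= 1.
  apply/andP; split; apply/ler_addgt0Pr => e /near[k [_ lt_e _]];
  by have [/andP[] + + _ _ _] := uP k; move: lt_e; rewrite ltr_distl; norm_lra.
have Fz : evp F z = segment y0 y1 s.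
  apply/eqP; rewrite -subr_eq0 -l1norm_eq0 eq_le l1norm_ge0 andbT.
  apply/ler_addgt0Pr => e e0; rewrite add0r.
  have e30 : 0 < e / 3 by rewrite divr_gt0.
  have [d d0 dP] := evp_continuous F z e30.
  pose M := l1norm (y1 - y0) + 1; have M0 : 0 < M by rewrite ltr_wpDl ?l1norm_ge0.
  have [|k [ltz lts lty]] := near (Num.min d (Num.min (e / 3) (e / 3 / M))).
    by rewrite !lt_min d0 !divr_gt0.
  rewrite !lt_min in ltz lts lty; case/and3P: ltz => ltz _ _.
  case/and3P: lts => _ _ lts; case/and3P: lty => _ lty _.
  have := dP _ ltz; have := l1norm_tri (evp F (u k).1) (evp F z) (segment y0 y1 s).
  rewrite [l1norm (evp F z - evp F _)]l1normBC.
  have := l1norm_tri (segment y0 y1 (u k).2) (evp F (u k).1) (segment y0 y1 s).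
  have -> : segment y0 y1 (u k).2 - segment y0 y1 s =
            ((u k).2 - s)%:C *: (y1 - y0).
    by rewrite /segment rmorphB opprD addrACA subrr add0r -scaleNr -scalerDl.
  have : l1norm (((u k).2 - s)%:C *: (y1 - y0)) <= e / 3.
    rewrite l1normZ cabs_real; move: lts; rewrite ltr_pdivlMr // => /ltW; apply: le_trans.
    by rewrite ler_wpM2l // lerDl.
  norm_lra.
have [r r0 rP] := Kint s z s01 Kz Fz.
have r20 : 0 < r / 2 by rewrite divr_gt0.
have [k [ltz _ _]] := near _ r20; have [_ _ _ []] := uP k.
exists (r / 2) => // z' lt_z'; apply: rP.
by apply: le_lt_trans (l1norm_tri (u k).1 _ _) _; norm_lra.
Qed.

(* [F] is perturbed to [F + t (z - z0)], whose Jacobian does not vanish at [z0];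
   the segment is perturbed so as to avoid the critical values. *)
Lemma path_lifting K F z0 y1 (B : R) : adherent_closed K ->
  (forall z, K z -> l1norm z <= B) -> K z0 ->
  (forall (s : R) z, 0 <= s <= 1 -> K z ->
     evp F z = segment (evp F z0) y1 s -> interior_point K z) ->
  exists2 z, K z & evp F z = y1.
Proof.
move=> Kcl KB Kz0 Kint; set y0 := evp F z0 in Kint *.
have [eta eta0 etaP] := boundary_gap Kcl KB Kint.
have [r r0 rP] : interior_point K z0.
  by apply: (Kint 0) => //; rewrite ?lexx ?ler01 // /segment scale0r addr0.
(* It is enough to come within every [e'] of [y1], which leaves room for the perturbations. *)
apply: (compact_solution Kcl KB) => e' e'0.
pose e := Num.min e' eta.
have e0 : 0 < e by rewrite lt_min e'0.
have [le_e' le_eta] : e <= e' /\ e <= eta by rewrite !ge_min !lexx orbT.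
pose M := B + l1norm z0 + 1.
have M0 : 0 < M by have := l1norm_ge0 z0; have := KB _ Kz0; rewrite /M; norm_lra.
have e4 : 0 < e / 4 by rewrite divr_gt0.
pose q := char_poly (- jac F z0).
(* At [t], the characteristic polynomial of [- jac F z0] equals the determinant of [jac F z0 + t I],
   the Jacobian of the perturbed map at [z0]. Division by [M] makes the perturbation smaller than e
   / 4 on [K]. *)
have [t lt_t qt] := poly_avoid_small (monic_neq0 (char_poly_monic (- jac F z0))) (divr_gt0 e4 M0).
pose Ft j := F j + t *: (mpolyX R[i] (mnm1 j) - mpolyC n (z0 0 j)).
have FtE z : evp Ft z = evp F z + t *: (z - z0).
  by apply/rowP => j; rewrite !mxE mevalD mevalZ mevalB mevalXU mevalC.
have Ft_near z : K z -> l1norm (evp Ft z - evp F z) < e / 4.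
  move=> Kz; rewrite FtE addrAC subrr add0r l1normZ.
  move: lt_t; rewrite ltr_pdivlMr //; apply: le_lt_trans.
  apply: ler_wpM2l; first exact: cabs_ge0.
  by rewrite /M; have := l1normB z z0; have := KB _ Kz; norm_lra.
have det0 : \det (jac Ft z0) != 0.
  suff -> : \det (jac Ft z0) = (char_poly (- jac F z0)).[t] by [].
  rewrite /char_poly -horner_evalE -det_map_mx; congr (\det _); apply/matrixP => i j.
  rewrite !mxE mderivD mevalD linearZ mevalZ linearB /= mderivC subr0 mderivX.
  rewrite /horner_eval hornerD hornerN hornerC opprK hornerMn hornerX addrC; congr (_ + _).
  rewrite mnm1E; case: (eqVneq i j) => [->|nij].
    rewrite scale1r.
    have -> : mnm_sub (mnm1 j) (mnm1 j) = @mnm0 n.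
      by apply/mnmP => l; rewrite mnmBE subnn mnm0E.
    by rewrite mpolyX0 meval1 mulr1.
  by rewrite scale0r meval0 mulr0.
have J0 : \det (jacobian Ft) != 0.
  by apply: contraNneq det0 => J0; rewrite /jac det_map_mx J0 rmorph0.
have [D D0 DP] := critical_values_polynomial Ft J0.
have noncritical z : meval (evp Ft z 0) D != 0 -> \det (jac Ft z) != 0.
  apply: contraNneq; rewrite /jac det_map_mx => /DP <-.
  by apply/eqP; apply: meval_eq => j; rewrite mxE.
have [rho rho0 rhoP] := local_surjectivity det0 r0.
have Ftz0 : evp Ft z0 = y0 by rewrite FtE subrr scaler0 addr0.
(* The starting value is moved off the zero set of [D], which contains the critical values, but
   stays close enough to [y0] to be attained near [z0]. *)
have [y0' y0'_near Dy0'] := @mpoly_avoid _ _ D y0 (Num.min rho (e / 4)) D0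
  ltac:(by rewrite lt_min rho0 e4).
rewrite lt_min in y0'_near; case/andP: y0'_near => y0'rho y0'e.
have [z0' /rP Kz0' Ftz0'] := rhoP y0' ltac:(by rewrite Ftz0).
have [q1 q1E] := mpoly_on_line D y0' (y1 - y0').
have N0 : 0 < l1norm (y1 - y0') + 1 by rewrite ltr_wpDl ?l1norm_ge0.
(* Turning the segment by a complex factor [c] close to 1 makes all of it avoid the zeros of [D], as
   its origin already does. *)
have [c c_near cP] := @poly_avoid_ray _ q1 (e / 4 / (l1norm (y1 - y0') + 1))
  ltac:(by rewrite q1E scale0r addr0) (divr_gt0 e4 N0).
pose y (s : R) := y0' + (s%:C * c) *: (y1 - y0').
have y_near s : 0 <= s <= 1 -> l1norm (y s - segment y0 y1 s) < e / 4.
  move=> /andP[s0 s1].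
  have -> : y s - segment y0 y1 s =
      (1 - s)%:C *: (y0' - y0) + s%:C *: ((c - 1) *: (y1 - y0')).
    by rewrite rmorphB; exact: segment_perturbation.
  apply: le_lt_trans (l1normD _ _) _; rewrite !l1normZ !cabs_real !ger0_norm ?subr_ge0 //.
  have lt2 : cabs (c - 1) * l1norm (y1 - y0') <= e / 4.
    move: c_near; rewrite ltr_pdivlMr //; have := cabs_ge0 (c - 1); norm_lra.
  have : (1 - s) * l1norm (y0' - y0) <= (1 - s) * (e / 4) by rewrite ler_wpM2l ?subr_ge0 // ltW.
  have : s * (cabs (c - 1) * l1norm (y1 - y0')) <= s * (e / 4) by rewrite ler_wpM2l.
  have [s_lt1|s_ge1] := ltP s 1.
    have : (1 - s) * l1norm (y0' - y0) < (1 - s) * (e / 4) by rewrite ltr_pM2l ?subr_gt0.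
    by norm_lra.
  have -> : s = 1 by norm_lra.
  move=> _ _; rewrite subrr !mul0r !mul1r add0r.
  move: c_near; rewrite ltr_pdivlMr //; have := cabs_ge0 (c - 1); norm_lra.
pose E s := exists2 z, K z & evp Ft z = y s.
have E_int s z : 0 <= s <= 1 -> K z -> evp Ft z = y s -> interior_point K z.
  move=> s01 Kz Ftz; apply: (etaP s) => //.
  have := Ft_near _ Kz; have := y_near _ s01; rewrite Ftz => lt1 lt2.
  by have := l1norm_tril (evp F z) (y s) (segment y0 y1 s); norm_lra.
have yB s s' : y s' - y s = (s' - s)%:C *: (c *: (y1 - y0')).
  by rewrite rmorphB opprD addrACA subrr add0r -scalerBl -mulrBl scalerA.
have cN0 : 0 < l1norm (c *: (y1 - y0')) + 1 by rewrite ltr_wpDl ?l1norm_ge0.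
have yc s (d : R) : 0 < d -> exists2 d', 0 < d' & forall s', `|s' - s| < d' ->
    l1norm (y s' - y s) < d.
  move=> d0; exists (d / (l1norm (c *: (y1 - y0')) + 1)); first by rewrite divr_gt0.
  move=> s'; rewrite ltr_pdivlMr //; apply: le_lt_trans.
  by rewrite yB (l1normZ (s' - s)%:C) cabs_real ler_wpM2l // lerDl.
have [z Kz Ftz] : E 1.
  (* The set of liftable parameters is closed by compactness of [K]. It is open because a lift is
     interior to [K] and noncritical, so that [local_surjectivity] applies there. *)
  apply: (@interval_induction _ E 1) => //.
  - by exists z0'; [exact: Kz0'|rewrite Ftz0' /y mul0r scale0r addr0].
  - move=> s s01 Es; apply: (compact_solution Kcl KB) => d d0.
    have [d' d'0 d'P] := yc s d d0; have [s' [_ [z Kz Ftz] lt_s']] := Es _ d'0.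
    by exists z => //; rewrite Ftz d'P.
  move=> s /andP[s0 s1] [z Kz Ftz].
  have s01 : 0 <= s <= 1 by rewrite s0 ltW.
  have [r' r'0 r'P] := E_int _ _ s01 Kz Ftz.
  have det_z : \det (jac Ft z) != 0.
    by apply: noncritical; rewrite Ftz -q1E cP.
  have [rho' rho'0 rho'P] := local_surjectivity det_z r'0.
  have [d' d'0 d'P] := yc s _ rho'0; exists d' => // s' /andP[ss' s's].
  have [|z' lt_z' Ftz'] := rho'P (y s').
    by rewrite Ftz; apply: d'P; rewrite ger0_norm ?subr_ge0 //; norm_lra.
  by exists z' => //; exact: r'P.
have seg1 : segment y0 y1 1 = y1 by rewrite /segment rmorph1 scale1r subrKC.
have lt1 : l1norm (y 1 - y1) < e / 4.
  by rewrite -[in X in _ - X]seg1; apply: y_near; rewrite lexx ler01.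
exists z => //; have := Ft_near _ Kz; rewrite Ftz.
by have := l1norm_tril (evp F z) (y 1) y1; norm_lra.
Qed.

End PathLifting.

(** * The cone of limit directions of the image *)

Section Cone.
Variables (R : realType) (n m : nat) (f : 'I_m -> mpoly n R[i]).
Implicit Types (p q : 'rV[R[i]]_m) (z : 'rV[R[i]]_n).

Definition limit_cone p := forall e, 0 < e ->
  exists z (c : R[i]), l1norm z < e /\ l1norm (c *: evp f z - p) < e.

(** [reducing_limit_cone] and [not_reducing] show that this holds exactly when the columns of [V],
    taken as linear forms, have no common zero other than 0 on the limit cone. *)
Definition reducing k (V : 'M[R[i]]_(m, k)) := exists c d : R,
  [/\ 0 < c, 0 < d & forall z, l1norm z < d -> l1norm (evp f z) <= c * l1norm (evp f z *m V)].

Lemma limit_cone0 : limit_cone 0.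
Proof. by move=> e e0; exists 0, 0; rewrite scale0r subrr !l1norm0. Qed.

Lemma limit_coneZ a p : limit_cone p -> limit_cone (a *: p).
Proof.
move=> Cp e e0; have a0 : 0 < cabs a + 1 by rewrite ltr_wpDl ?cabs_ge0.
have [|z [c [lt_z lt_c]]] := Cp (Num.min e (e / (cabs a + 1))).
  by rewrite lt_min e0 divr_gt0.
rewrite !lt_min in lt_z lt_c; case/andP: lt_z => lt_z _; case/andP: lt_c => _ lt_c.
exists z, (a * c); split=> //; rewrite -scalerA -scalerBr l1normZ.
move: lt_c; rewrite ltr_pdivlMr // mulrC; apply: le_lt_trans.
by rewrite ler_wpM2r ?l1norm_ge0 // lerDl.
Qed.

Lemma reducing_limit_cone k (V : 'M[R[i]]_(m, k)) : reducing V ->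
  exists2 c, 0 < c & forall p, limit_cone p -> l1norm p <= c * l1norm (p *m V).
Proof.
move=> [c [d [c0 d0 H]]]; exists c => // p Cp; apply/ler_addgt0Pr => e e0.
have V0 := mxnorm_ge0 V; set M := mxnorm V in V0.
have cM0 : 0 < c * M + 1 by rewrite ltr_wpDl // mulr_ge0 // ltW.
have [|z [a [lt_z lt_a]]] := Cp (Num.min d (e / (c * M + 1))).
  by rewrite lt_min d0 divr_gt0.
rewrite !lt_min in lt_z lt_a; case/andP: lt_z => lt_z _; case/andP: lt_a => _.
rewrite ltr_pdivlMr // => lt_a.
have le1 : l1norm (a *: evp f z) <= c * l1norm (a *: evp f z *m V).
  rewrite -scalemxAl !l1normZ mulrCA; apply: ler_wpM2l; first exact: cabs_ge0.
  exact: H.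
have le2 : l1norm (a *: evp f z *m V) <= l1norm (p *m V) + l1norm (a *: evp f z - p) * M.
  apply: le_trans (l1norm_le_dist _ (p *m V)) _; rewrite lerD2l -mulmxBl.
  exact: l1norm_mulmx.
have le3 := l1norm_le_dist p (a *: evp f z); rewrite [l1norm (p - _)]l1normBC in le3.
have : c * l1norm (a *: evp f z *m V) <= c * (l1norm (p *m V) + l1norm (a *: evp f z - p) * M).
  by rewrite ler_wpM2l // ltW.
move: le1 le3 lt_a; norm_lra.
Qed.

Lemma limit_cone_cluster (u : nat -> 'rV[R[i]]_n) (c : nat -> R[i]) (B : R) :
  (forall e, 0 < e -> exists k0, forall k, (k0 <= k)%N -> l1norm (u k) < e) ->
  (forall k, l1norm (c k *: evp f (u k)) <= B) ->
  exists p (phi : nat -> nat), limit_cone p /\ forall k,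
    (k <= phi k)%N /\ l1norm (c (phi k) *: evp f (u (phi k)) - p) < k.+1%:R^-1.
Proof.
move=> u0 cB; have [p [phi phiP]] := bolzano_weierstrass cB.
exists p, phi; split=> // e e0; have [k0 k0P] := u0 e e0.
have [k ke] := ltr_add_invr e0; rewrite add0r in ke.
pose N := maxn k0 k; exists (u (phi N)), (c (phi N)); split.
  by apply: k0P; apply: leq_trans (phiP N).1; exact: leq_maxl.
apply: lt_trans (phiP N).2 _; apply: le_lt_trans ke.
by rewrite lef_pV2 ?posrE ?ltr0n // ler_nat ltnS leq_maxr.
Qed.

Lemma invS_small (e : R) : 0 < e -> exists k0, forall k, (k0 <= k)%N -> k.+1%:R^-1 < e.
Proof.
move=> e0; have [k0 ke] := ltr_add_invr e0; rewrite add0r in ke.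
exists k0 => k le_k; apply: le_lt_trans ke.
by rewrite lef_pV2 ?posrE ?ltr0n // ler_nat ltnS.
Qed.

Lemma limit_mulmx_le k (u : nat -> 'rV[R[i]]_m) p (M : 'M[R[i]]_(m, k)) y (r C : R) :
  (forall j, l1norm (u j - p) < j.+1%:R^-1) ->
  (forall j, l1norm (u j *m M - y) <= r + C * j.+1%:R^-1) -> l1norm (p *m M - y) <= r.
Proof.
move=> up uM; apply/ler_addgt0Pr => e e0.
have M0 := mxnorm_ge0 M; set N := mxnorm M in M0.
have CN0 : 0 < `|C| + N + 1 by rewrite ltr_wpDl ?addr_ge0.
have [j0 /(_ j0 (leqnn _))] := invS_small (divr_gt0 e0 CN0).
rewrite ltr_pdivlMr //; set i := _^-1 => lt_i.
have i0 : 0 <= i by rewrite invr_ge0 ler0n.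
have lt1 : l1norm (u j0 - p) < i := up j0.
have lt2 : l1norm (u j0 *m M - y) <= r + C * i := uM j0.
have lt3 : l1norm (p *m M - y) <= l1norm (u j0 *m M - y) + l1norm (u j0 - p) * N.
  apply: le_trans (l1norm_tril _ (u j0 *m M) _) _; rewrite lerD2l -mulmxBl.
  exact: l1norm_mulmx.
have : C * i <= `|C| * i by rewrite ler_wpM2r // ler_norm.
have : l1norm (u j0 - p) * N <= i * N by rewrite ler_wpM2r // ltW.
norm_lra.
Qed.

Lemma limit_mulmx_ge k (u : nat -> 'rV[R[i]]_m) p (M : 'M[R[i]]_(m, k)) y (r : R) :
  (forall j, l1norm (u j - p) < j.+1%:R^-1) ->
  (forall j, r <= l1norm (u j *m M - y)) -> r <= l1norm (p *m M - y).
Proof.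
move=> up uM; apply/ler_addgt0Pr => e e0.
have M0 := mxnorm_ge0 M; set N := mxnorm M in M0.
have CN0 : 0 < N + 1 by rewrite ltr_wpDl.
have [j0 /(_ j0 (leqnn _))] := invS_small (divr_gt0 e0 CN0).
rewrite ltr_pdivlMr //; set i := _^-1 => lt_i.
have i0 : 0 <= i by rewrite invr_ge0 ler0n.
have lt1 : l1norm (u j0 - p) < i := up j0.
have lt2 : r <= l1norm (u j0 *m M - y) := uM j0.
have lt3 : l1norm (u j0 *m M - y) <= l1norm (p *m M - y) + l1norm (u j0 - p) * N.
  apply: le_trans (l1norm_tri (p *m M) _ _) _; rewrite addrC lerD2l -mulmxBl.
  exact: l1norm_mulmx.
have : l1norm (u j0 - p) * N <= i * N by rewrite ler_wpM2r // ltW.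
norm_lra.
Qed.

Lemma limit_mulmx k (u : nat -> 'rV[R[i]]_m) p (M : 'M[R[i]]_(m, k)) y (C : R) :
  (forall j, l1norm (u j - p) < j.+1%:R^-1) ->
  (forall j, l1norm (u j *m M - y) <= C * j.+1%:R^-1) -> p *m M = y.
Proof.
move=> up uM; apply/eqP; rewrite -subr_eq0 -l1norm_eq0 eq_le l1norm_ge0 andbT.
by apply: limit_mulmx_le up _ => j; rewrite add0r; exact: uM.
Qed.

(** Failure for every constant gives points [u N] tending to 0 where f V is negligible against f. A
    cluster point of the normalised values of f has norm 1 and is killed by [V]. *)
Lemma not_reducing k (V : 'M[R[i]]_(m, k)) : ~ reducing V ->
  exists p, [/\ limit_cone p, p != 0 & p *m V = 0].
Proof.
move=> nV.
have bad N : exists z, l1norm z < N.+1%:R^-1 /\ l1norm (evp f z) > N.+1%:R * l1norm (evp f z *m V).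
  apply: contrapT => nbad; apply: nV; exists N.+1%:R, N.+1%:R^-1.
  split; rewrite ?invr_gt0 ?ltr0n // => z lt_z; rewrite leNgt; apply/negP => lt_V.
  by apply: nbad; exists z.
have [u uP] := boolp.choice bad.
have fu0 N : 0 < l1norm (evp f (u N)).
  by apply: le_lt_trans (uP N).2; rewrite mulr_ge0 ?ler0n ?l1norm_ge0.
pose c N : R[i] := ((l1norm (evp f (u N)))^-1)%:C.
have cE N : cabs (c N) = (l1norm (evp f (u N)))^-1.
  by rewrite cabs_real ger0_norm // invr_ge0 l1norm_ge0.
have nm1 N : l1norm (c N *: evp f (u N)) = 1 by rewrite l1normZ cE mulVf // gt_eqF.
have [e e0|N|p [phi [Cp phiP]]] := @limit_cone_cluster u c 1.
- have [k0 k0P] := invS_small e0; exists k0 => N /k0P; apply: lt_trans.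
  exact: (uP N).1.
- by rewrite nm1.
pose q N := c (phi N) *: evp f (u (phi N)).
have qp j : l1norm (q j - p) < j.+1%:R^-1 := (phiP j).2.
exists p; split=> //.
  apply/eqP => p0; have : (1 : R) <= l1norm (p *m 1%:M - 0).
    by apply: (limit_mulmx_ge qp) => j; rewrite mulmx1 subr0 /q nm1.
  by rewrite p0 mul0mx subr0 l1norm0 ler10.
apply: (limit_mulmx (C := 1) qp) => j.
rewrite subr0 mul1r /q -scalemxAl l1normZ cE.
apply: (@le_trans _ _ (phi j).+1%:R^-1); last first.
  by rewrite lef_pV2 ?posrE ?ltr0n // ler_nat ltnS (phiP j).1.
by rewrite mulrC ler_pdivrMr // ler_pdivlMl ?ltr0n // ltW // (uP (phi j)).2.
Qed.

(** With |V' - V| below 1 / (2c), replacing [V] by [V'] costs at most half of |f|, which is absorbed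
    by doubling the constant. *)
Lemma reducing_open k (V : 'M[R[i]]_(m, k)) : reducing V ->
  exists2 e, 0 < e & forall V' : 'M[R[i]]_(m, k), mxnorm (V' - V) < e -> reducing V'.
Proof.
move=> [c [d [c0 d0 H]]]; exists (2 * c)^-1; first by rewrite invr_gt0 mulr_gt0.
move=> V' lt_V; exists (2 * c), d; split; rewrite ?mulr_gt0 // => z /H le_z.
have lt2 : c * mxnorm (V' - V) <= 2^-1.
  by rewrite ltW // -ltr_pdivlMl // mulrC -invfM.
have f0 := l1norm_ge0 (evp f z).
have le3 : l1norm (evp f z *m V) <= l1norm (evp f z *m V') + l1norm (evp f z) * mxnorm (V' - V).
  apply: le_trans (l1norm_le_dist _ (evp f z *m V')) _.
  by rewrite lerD2l l1normBC -mulmxBr; exact: l1norm_mulmx.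
have : c * l1norm (evp f z *m V) <= c * (l1norm (evp f z *m V') + l1norm (evp f z) * mxnorm (V' - V)).
  by rewrite ler_wpM2l ?(ltW c0).
have : l1norm (evp f z) * (c * mxnorm (V' - V)) <= l1norm (evp f z) * 2^-1 by rewrite ler_wpM2l.
norm_lra.
Qed.

End Cone.

(** * Lowest forms of relations and Noether normalisation *)

Definition lincomb (R : realType) (n m k : nat) (f : 'I_m -> mpoly n R[i])
    (V : 'M[R[i]]_(m, k)) (j : 'I_k) : mpoly n R[i] := \sum_(i < m) V i j *: f i.

Section NoetherNormalisation.
Variables (R : realType) (n m : nat) (f : 'I_m -> mpoly n R[i]).
Hypothesis f0 : evp f 0 = 0.

Lemma evp_lincomb k (V : 'M[R[i]]_(m, k)) z : evp (lincomb f V) z = evp f z *m V.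
Proof.
apply/rowP => j; rewrite !mxE (raddf_sum (meval _)); apply: eq_bigr => i _.
by rewrite /= mevalZ !mxE mulrC.
Qed.

Lemma msize_lincomb k (V : 'M[R[i]]_(m, k)) d j :
  (forall i, (msize (f i) <= d)%N) -> (msize (lincomb f V j) <= d)%N.
Proof.
move=> le_d; apply: leq_trans (msize_sum _ _ _) _; apply/bigmax_leqP => i _.
exact: leq_trans (mmeasureZ_le _ _ _) (le_d i).
Qed.

(** If c f(z) tends to [p] with [p] nonzero and f(z) tends to 0, then c tends to infinity. Since
    P(f(z) W) = c^(-s) G(c f(z) W, 1/c), the limit gives G(p W, 0) = Q(p W) = 0. *)
Lemma tangent_form k (W : 'M[R[i]]_(m, k)) (P : mpoly k R[i]) : P != 0 ->
  (forall z, meval ((evp f z *m W) 0) P = 0) ->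
  exists s (Q : mpoly k R[i]), [/\ Q != 0, {subset msupp Q <= msupp P},
    forall c x, meval ((c *: x : 'rV_k) 0) Q = c ^+ s * meval (x 0) Q
    & forall p, limit_cone f p -> meval ((p *m W) 0) Q = 0].
Proof.
move=> P0 Pf; have [s [Q [G [Q0 QP Qhom PG GQ]]]] := lowest_form P0.
exists s, Q; split=> // p Cp.
apply/eqP; rewrite -GQ; apply: contraT => G0; set x0 := row_mx _ _ in G0.
have G0' : 0 < cabs (meval (x0 0) G) by rewrite cabs_gt0.
have [d d0 dP] := meval_continuous G x0 G0'.
have Gn x (c : R[i]) : l1norm (x - p *m W) + cabs c < d -> c != 0 ->
    meval ((c *: x) 0) P != 0.
  move=> lt_d c0; rewrite PG mulf_neq0 ?expf_neq0 //.
  have := dP (row_mx x (c%:M : 'M[R[i]]_1)).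
  rewrite /x0 opp_row_mx add_row_mx l1norm_row_mx -raddfB subr0 l1norm_scalar => /(_ lt_d).
  by apply: contraTneq => ->; rewrite sub0r cabsN ltxx.
(* For p = 0 the multipliers need not be large; instead P(0) = 0, because f(0) = 0. *)
have [p0|p0] := eqVneq p 0.
  have d20 : 0 < d / 2 by rewrite divr_gt0.
  have := Gn 0 (d / 2)%:C; rewrite scaler0 p0 mul0mx subrr l1norm0 add0r cabs_real.
  have -> : meval ((0 : 'rV_k) 0) P = 0 by rewrite -(Pf 0) f0 mul0mx.
  rewrite eqxx; apply.
    by rewrite ger0_norm ?ltW // ltr_pdivrMr // ltr_pMr // ltr1n.
  by rewrite -cabs_eq0 cabs_real normr_eq0 gt_eqF.
have np0 : 0 < l1norm p by rewrite l1norm_gt0.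
have d20 : 0 < d / 2 by rewrite divr_gt0.
have M0 : 0 < mxnorm W + 1 by rewrite ltr_wpDl ?mxnorm_ge0.
(* As |c| |f(z)| is at least |p| / 2, the bound |f(z)| < [e1] forces |c|^-1 < d / 2. *)
pose e1 := l1norm p / 2 * (d / 2) / 2.
have e10 : 0 < e1 by rewrite /e1 !(divr_gt0, mulr_gt0).
have [d1 d10 d1P] := evp_continuous f 0 e10; rewrite f0 in d1P.
have [|z [c [lt_z lt_c]]] := Cp (Num.min d1 (Num.min (l1norm p / 2) (d / 2 / (mxnorm W + 1)))).
  by rewrite !lt_min d10 !divr_gt0.
rewrite !lt_min in lt_z lt_c; case/and3P: lt_z => lt_z _ _.
case/and3P: lt_c => _ lt_c1 lt_c2.
have lt_f : l1norm (evp f z) < e1 by have := d1P z; rewrite !subr0; exact.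
have le_p : l1norm p <= cabs c * l1norm (evp f z) + l1norm p / 2.
  rewrite -l1normZ; apply: le_trans (l1norm_le_dist _ (c *: evp f z)) _.
  by rewrite lerD2l l1normBC ltW.
have c0 : c != 0.
  apply: contraTneq le_p => ->; rewrite cabs0 mul0r add0r -ltNge.
  by rewrite ltr_pdivrMr // ltr_pMr // ltr1n.
have nc0 : 0 < cabs c by rewrite cabs_gt0.
have := Gn (c *: evp f z *m W) c^-1; rewrite -scalemxAl scalerA mulVf // scale1r.
rewrite Pf eqxx; apply; last by rewrite invr_eq0.
rewrite cabsV scalemxAl -mulmxBl.
have lt1 : l1norm ((c *: evp f z - p) *m W) < d / 2.
  apply: le_lt_trans (l1norm_mulmx _ _) _; move: lt_c2; rewrite ltr_pdivlMr //.
  by apply: le_lt_trans; rewrite ler_wpM2l ?l1norm_ge0 // lerDl.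
have lt2 : (cabs c)^-1 < d / 2.
  rewrite -[ltLHS]mulr1 ltr_pdivrMl //.
  have : l1norm p / 2 <= cabs c * l1norm (evp f z) by move: le_p; norm_lra.
  have : cabs c * l1norm (evp f z) < cabs c * e1 by rewrite ltr_pM2l.
  move=> lt3 le3; have := le_lt_trans le3 lt3; rewrite /e1 mulrA [cabs c * _]mulrCA.
  move=> lt4; have : l1norm p / 2 * 1 < l1norm p / 2 * (cabs c * (d / 2) / 2).
    by rewrite mulr1 !mulrA in lt4 *.
  rewrite ltr_pM2l ?divr_gt0 // => lt5; apply: lt_trans lt5 _.
  by rewrite ltr_pdivrMr // ltr_pMr ?ltr1n // mulr_gt0.
by rewrite (splitr d); apply: ltrD.
Qed.

(** The cokernel matrix of [y] has rank [k], and its column base gives [M]. *)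
Lemma projection_along (K : fieldType) k (y : 'rV[K]_(k + 1)) : y != 0 ->
  exists M : 'M[K]_(k + 1, k), forall x : 'rV_(k + 1), x *m M = 0 -> exists c, x = c *: y.
Proof.
move=> y0.
have rk : \rank (cokermx y) = k by rewrite mxrank_coker rank_rV y0 addnK.
move: (col_base (cokermx y)) (row_base (cokermx y))
  (row_base_free (cokermx y)) (mulmx_base (cokermx y)); rewrite rk => M N _ MN.
exists M => x xM0; apply/sub_rVP; rewrite submxE -MN mulmxA xM0.
by rewrite mul0mx.
Qed.

(** As k + 1 > n, the k + 1 combinations of f are algebraically dependent, and the lowest form [Q]
    of a relation vanishes on the image of the limit cone. By homogeneity the line through a point
    [y] with Q(y) nonzero meets this image only in 0, so projecting along [y] creates no new common
    zero. *)
Lemma reducing_project k (V : 'M[R[i]]_(m, k + 1)) : (n <= k)%N -> reducing f V ->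
  exists V' : 'M[R[i]]_(m, k), reducing f V'.
Proof.
move=> le_nk redV.
pose d := (\max_i msize (f i)).+1.
have le_d i : (msize (f i) <= d.+1)%N.
  by apply: leq_trans (leqW (leqnSn _)); exact: (leq_bigmax i).
have [P [P0 _ Pf]] :=
  algebraic_relation (ltn0Sn _) le_nk (fun j => msize_lincomb V j le_d).
have [z|s [Q [Q0 _ Qhom QC]]] := @tangent_form _ V P P0.
  rewrite -[RHS](Pf (z 0)); apply: meval_eq => j.
  by rewrite -evp_lincomb mxE.
have [y' Qy'] := mpoly_neq0_meval Q0.
pose y : 'rV_(k + 1) := \row_j y' j.
have Qy : meval (y 0) Q != 0.
  have <- : meval y' Q = meval (y 0) Q by apply: meval_eq => j; rewrite mxE.
  exact: Qy'.
have y0 : y != 0.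
  apply: contraNneq Qy => ->; have := QC _ (limit_cone0 f).
  by rewrite mul0mx => ->.
have [M MP] := projection_along y0; exists (V *m M).
apply: contrapT => /not_reducing[p [Cp p0]]; rewrite mulmxA => /MP[c pV].
have := QC p Cp; rewrite pV Qhom => /eqP; rewrite mulf_eq0 (negPf Qy) orbF expf_eq0.
case/andP=> _ /eqP c0.
have [c1 c10 /(_ p Cp)] := reducing_limit_cone redV.
by rewrite pV c0 scale0r l1norm0 mulr0 leNgt l1norm_gt0 p0.
Qed.

Lemma noether_normalisation : (n <= m)%N -> exists V : 'M[R[i]]_(m, n), reducing f V.
Proof.
move=> le_nm.
suff H k : (k + n <= m)%N -> exists V : 'M[R[i]]_(m, m - k), reducing f V.
  by have := H (m - n)%N; rewrite subKn // subnK // => /(_ (leqnn _)).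
elim: k => [|k IHk] le_k.
  rewrite subn0; exists 1%:M, 1, 1; split=> // z _.
  by rewrite mulmx1 mul1r.
have [|V redV] := IHk; first exact: leq_trans le_k.
have E : (m - k = (m - k.+1) + 1)%N by lia.
rewrite E in V redV; apply: reducing_project redV; lia.
Qed.

End NoetherNormalisation.

(** * Fibres of the limit cone *)

Lemma segmentD (R : realType) k (y d : 'rV[R[i]]_k) (s : R) :
  segment y (y + d) s = y + s%:C *: d.
Proof. by rewrite /segment [y + d]addrC addrK. Qed.

Section FibreOpen.
Variables (R : realType) (n m : nat) (f : 'I_m -> mpoly n R[i]).
Variable delta0 : R.
Hypothesis f0 : evp f 0 = 0.
Hypothesis delta0_gt0 : 0 < delta0.
Hypothesis fin : forall z, l1norm z <= delta0 -> evp f z = 0 -> z = 0.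

(** The minimum of |f| on the compact shell between the radii [e] and [delta0] is positive, since 0
    is the only zero of f in the ball. The shell may be empty, hence the case distinction. *)
Lemma small_fibre (e : R) : 0 < e -> exists2 eta, 0 < eta &
  forall z, l1norm z <= delta0 -> l1norm (evp f z) < eta -> l1norm z < e.
Proof.
move=> e0.
have [[z1 Sz1]|nS] := pselect (exists z : 'rV[R[i]]_n, l1norm z <= delta0 /\ e <= l1norm z); last first.
  exists 1 => // z zd _; rewrite ltNge; apply/negP => ez.
  by apply: nS; exists z.
have [|||||z [zd ez] zmin] := @compact_minimum _ _
    (fun z : 'rV[R[i]]_n => l1norm z <= delta0 /\ e <= l1norm z) (fun z => l1norm (evp f z)) delta0.
- by exists z1.
- by move=> z [].
- move=> p H; split; apply/ler_addgt0Pr => e' /H[z [zd ez] lt_z].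
    by have := l1norm_le_dist p z; rewrite l1normBC; move: lt_z zd; norm_lra.
  by have := l1norm_le_dist z p; move: lt_z ez; norm_lra.
- by move=> z; exact: l1norm_ge0.
- move=> p e' e'0; have [d d0 dP] := evp_continuous f p e'0; exists d => // z /dP.
  by have := l1norm_le_dist (evp f p) (evp f z); rewrite l1normBC; norm_lra.
exists (l1norm (evp f z)).
  rewrite l1norm_gt0; apply: contraTneq ez => /(fin zd) ->.
  by rewrite l1norm0 -ltNge.
move=> z' z'd lt_z'; rewrite ltNge; apply/negP => ez'.
by have := zmin z' (conj z'd ez'); rewrite leNgt lt_z'.
Qed.

(* [V'] below is [V] with the coordinate along [v] replaced by the form [H];
   lifting segments of direction [v] through [f *m V'] moves the value of [H]. *)
Lemma fibre_open (V : 'M[R[i]]_(m, n)) (u : 'cV[R[i]]_n) (v w : 'rV[R[i]]_n)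
    (H : 'cV[R[i]]_m) (t : R[i]) (rho : R) :
  reducing f V -> v *m u = 1%:M -> w *m u = 0 -> w != 0 -> 0 < rho ->
  (forall q b T, limit_cone f q -> q *m V = w + b *: v -> cabs b < rho -> b != 0 ->
     q *m H = T%:M -> cabs (T - t) < rho -> False) ->
  (exists p, [/\ limit_cone f p, p *m V = w & p *m H = t%:M]) ->
  forall T, cabs (T - t) < rho ->
  exists q, [/\ limit_cone f q, q *m V = w & q *m H = T%:M].
Proof.
move=> redV vu wu w0 rho0 NV [p [Cp pV pH]] T ltT.
pose L := V *m (1%:M - u *m v); pose V' := L + H *m v.
have Lu : L *m u = 0 by rewrite /L -mulmxA mulmxBl mul1mx -mulmxA vu mulmx1 subrr mulmx0.
have V'u : V' *m u = H by rewrite /V' mulmxDl Lu add0r -mulmxA vu mulmx1.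
have V'L : V' *m (1%:M - u *m v) = L.
  by rewrite mulmxBr mulmx1 mulmxA V'u /V' addrK.
have vL : v *m (1%:M - u *m v) = 0 by rewrite mulmxBr mulmx1 mulmxA vu mul1mx subrr.
have VL q : q *m V = q *m L + q *m V *m u *m v.
  by rewrite /L mulmxA mulmxBr mulmx1 !mulmxA subrK.
have pL : p *m L = w by rewrite /L mulmxA pV mulmxBr mulmx1 mulmxA wu mul0mx subr0.
have p0 : p != 0 by apply: contraNneq w0 => p0; rewrite -pV p0 mul0mx.
have np0 : 0 < l1norm p by rewrite l1norm_gt0.
pose D := T - t.
have [c [d1 [c0 d10 cP]]] := redV.
pose delta := Num.min delta0 (d1 / 2).
have delta_gt0 : 0 < delta by rewrite lt_min delta0_gt0 divr_gt0.
have delta_le : delta <= delta0 by rewrite ge_min lexx.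
have delta_lt : delta < d1.
  apply: (@le_lt_trans _ _ (d1 / 2)); rewrite ?ge_min ?lexx ?orbT //.
  by rewrite ltr_pdivrMr // ltr_pMr // ltr1n.
pose sg := rho / 2.
have sg0 : 0 < sg by rewrite divr_gt0.
have sg_lt : sg < rho by rewrite ltr_pdivrMr // ltr_pMr // ltr1n.
(* A sequence of points and multipliers realising [p]. The multipliers grow at least linearly,
   because the values of f tend to 0 while [p] is nonzero. *)
have /boolp.choice[x xP] N : exists x : 'rV[R[i]]_n * R[i], [/\ l1norm x.1 < N.+1%:R^-1,
    l1norm (x.2 *: evp f x.1 - p) < N.+1%:R^-1, x.2 != 0 &
    N.+1%:R * (l1norm p / 2) <= cabs x.2].
  have i0 : (0 : R) < N.+1%:R^-1 by rewrite invr_gt0 ltr0n.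
  have [d d0 dP] := evp_continuous f 0 i0; rewrite f0 in dP.
  have [|z [a [lt_z lt_a]]] := Cp (Num.min N.+1%:R^-1 (Num.min (l1norm p / 2) d)).
    by rewrite !lt_min i0 divr_gt0.
  rewrite !lt_min in lt_z lt_a; case/and3P: lt_z => lt_z1 _ lt_zd.
  case/and3P: lt_a => lt_a1 lt_a2 _; exists (z, a).
  have ltf : l1norm (evp f z) < N.+1%:R^-1 by have := dP z; rewrite !subr0; exact.
  have le_a : N.+1%:R * (l1norm p / 2) <= cabs a.
    rewrite -ler_pdivlMl ?ltr0n // [leRHS]mulrC.
    apply: (@le_trans _ _ (cabs a * l1norm (evp f z))); last first.
      by rewrite ler_wpM2l ?cabs_ge0 // ltW.
    rewrite -l1normZ; have := l1norm_le_dist p (a *: evp f z); rewrite l1normBC.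
    by move: lt_a2; norm_lra.
  split=> //=; rewrite -cabs_gt0; apply: lt_le_trans le_a.
  by rewrite mulr_gt0 ?ltr0n // divr_gt0.
pose q N : 'rV[R[i]]_m := (x N).2 *: evp f (x N).1.
have qp N : l1norm (q N - p) < N.+1%:R^-1 by have [] := xP N.
(* Writing a for [(x N).2], these are the lifts at parameter [s]: a f(z) has the same image under
   [L] as [q N], its value under [H] is shifted by [s D], and the coordinate of a f(z) V along [v]
   is at most [sg]. *)
pose Sol N (s : R) z := [/\ 0 <= s <= 1, l1norm z <= delta,
  l1norm ((x N).2 *: evp f z *m V *m u) <= sg
  & (x N).2 *: evp f z *m V' = q N *m V' + (s%:C * D) *: v].
have SolL N s z : Sol N s z -> (x N).2 *: evp f z *m L = q N *m L.
  by case=> _ _ _ E; rewrite -V'L !mulmxA E mulmxDl -scalemxAl vL scaler0 addr0.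
have SolH N s z : Sol N s z -> (x N).2 *: evp f z *m H = q N *m H + (s%:C * D)%:M.
  case=> _ _ _ E; rewrite -V'u !mulmxA E mulmxDl -scalemxAl vu.
  by rewrite scalemx1.
(* As [V] is reducing, a bound on a f(z) V bounds a f(z): its part through [L] is that of [q N] and
   its coordinate along [v] is at most [sg]. *)
pose B := c * ((l1norm p + 1) * mxnorm L + sg * mxnorm v).
have inv_le1 N : N.+1%:R^-1 <= 1 :> R by rewrite invf_le1 ?ltr0n // ler1n.
have nqB N : l1norm (q N) <= l1norm p + 1.
  apply: le_trans (l1norm_le_dist _ p) _; rewrite lerD2l.
  exact: ltW (lt_le_trans (qp N) (inv_le1 N)).
have SolB N s z : Sol N s z -> l1norm ((x N).2 *: evp f z) <= B.
  move=> sol; have [_ zd bu _] := sol.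
  apply: (@le_trans _ _ (c * l1norm ((x N).2 *: evp f z *m V))).
    rewrite -scalemxAl !l1normZ mulrCA ler_wpM2l ?cabs_ge0 //.
    by apply: cP; apply: le_lt_trans delta_lt.
  rewrite ler_wpM2l ?(ltW c0) // VL; apply: le_trans (l1normD _ _) _.
  rewrite (SolL _ _ _ sol); apply: lerD; apply: le_trans (l1norm_mulmx _ _) _.
    by rewrite ler_wpM2r ?mxnorm_ge0.
  by rewrite ler_wpM2r ?mxnorm_ge0.
have B0 : 0 <= B.
  by rewrite mulr_ge0 ?(ltW c0) // addr_ge0 // mulr_ge0 ?mxnorm_ge0 ?(ltW sg0) ?addr_ge0 ?l1norm_ge0.
have Sol_small (e : R) : 0 < e ->
    exists N0, forall N s z, (N0 <= N)%N -> Sol N s z -> l1norm z < e.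
  move=> e0; have [eta eta0 etaP] := small_fibre e0.
  have B10 : 0 < B + 1 by rewrite ltr_wpDl.
  have [N0 N0P] := invS_small (divr_gt0 (mulr_gt0 eta0 (divr_gt0 np0 (ltr0n R 2))) B10).
  exists N0 => N s z /N0P; rewrite ltr_pdivlMr // => lt_i sol.
  have [_ zd _ _] := sol; apply: etaP; first exact: le_trans zd delta_le.
  have := SolB _ _ _ sol; rewrite l1normZ; have [_ _ _ le_x] := xP N => leB.
  have N10 : (0 : R) < N.+1%:R by rewrite ltr0n.
  have : N.+1%:R * (l1norm p / 2) * l1norm (evp f z) <= B.
    by apply: le_trans leB; rewrite ler_wpM2r ?l1norm_ge0.
  rewrite -mulrA -ler_pdivlMl // => le1.
  rewrite -(ltr_pM2l (divr_gt0 np0 (ltr0n R 2))) [ltRHS]mulrC.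
  apply: le_lt_trans le1 _; apply: le_lt_trans lt_i.
  by rewrite ler_wpM2l ?invr_ge0 ?ler0n // lerDl.
(* Solutions with N tending to infinity have small [z] and bounded multiples of f, hence cluster at
   a point of the cone; every closed condition passes to it. *)
have cluster (N : nat -> nat) (s : nat -> R) (z : nat -> 'rV[R[i]]_n) :
    (forall k, (k <= N k)%N) -> (forall k, Sol (N k) (s k) (z k)) ->
    exists r, [/\ limit_cone f r, r *m L = w, l1norm (r *m V *m u) <= sg,
      l1norm (r *m H - t%:M) <= cabs D &
      ((forall k, s k = 1) -> r *m H = T%:M) /\
      ((forall k, sg <= l1norm ((x (N k)).2 *: evp f (z k) *m V *m u)) ->
       sg <= l1norm (r *m V *m u))].
  move=> Nk sol.
  have [e e0|k|r [phi [Cr phiP]]] := @limit_cone_cluster _ _ _ f z (fun k => (x (N k)).2) B.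
  - have [N0 N0P] := Sol_small e e0; exists N0 => k le_k.
    by apply: N0P (sol k); apply: leq_trans le_k (Nk k).
  - exact: SolB (sol k).
  pose y j : 'rV[R[i]]_m := (x (N (phi j))).2 *: evp f (z (phi j)).
  have yr j : l1norm (y j - r) < j.+1%:R^-1 := (phiP j).2.
  have qpj j : l1norm (q (N (phi j)) - p) <= j.+1%:R^-1.
    apply: le_trans (ltW (qp _)) _; rewrite lef_pV2 ?posrE ?ltr0n // ler_nat ltnS.
    exact: leq_trans (phiP j).1 (Nk _).
  have yL j : l1norm (y j *m L - w) <= mxnorm L * j.+1%:R^-1.
    rewrite (SolL _ _ _ (sol (phi j))) -pL -mulmxBl; apply: le_trans (l1norm_mulmx _ _) _.
    by rewrite mulrC ler_wpM2l ?mxnorm_ge0.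
  have qpH j : l1norm (q (N (phi j)) *m H - t%:M) <= mxnorm H * j.+1%:R^-1.
    rewrite -pH -mulmxBl; apply: le_trans (l1norm_mulmx _ _) _.
    by rewrite mulrC ler_wpM2l ?mxnorm_ge0.
  exists r; split=> //.
  - exact: limit_mulmx yr yL.
  - have := @limit_mulmx_le _ _ _ y r (V *m u) 0 sg 0 yr.
    rewrite subr0 mulmxA; apply=> j; rewrite subr0 mul0r addr0 mulmxA.
    by have [] := sol (phi j).
  - apply: limit_mulmx_le yr _ => j.
    rewrite (SolH _ _ _ (sol (phi j))) addrAC; apply: le_trans (l1normD _ _) _.
    rewrite [leLHS]addrC l1norm_scalar cabsM cabs_real; apply: lerD; last exact: qpH.
    have [/andP[s0 s1] _ _ _] := sol (phi j).
    by rewrite ger0_norm // ler_piMl ?cabs_ge0.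
  split=> [s1|ge_sg].
    apply: (limit_mulmx (C := mxnorm H) yr) => j.
    rewrite (SolH _ _ _ (sol (phi j))) s1 mul1r.
    have -> : T%:M = t%:M + D%:M :> 'M[R[i]]_1 by rewrite -raddfD /= /D subrKC.
    by rewrite opprD addrACA subrr addr0.
  have := @limit_mulmx_ge _ _ _ y r (V *m u) 0 sg yr.
  rewrite subr0 mulmxA; apply=> j; rewrite subr0 mulmxA.
  exact: ge_sg.
have bE r : r *m V *m u = ((r *m V *m u) 0 0)%:M by rewrite [LHS]mx11_scalar.
have VE r : r *m L = w -> r *m V = w + (r *m V *m u) 0 0 *: v.
  by move=> rL; rewrite {1}VL rL {1}bE mul_scalar_mx.
have absurd r : limit_cone f r -> r *m L = w -> l1norm (r *m V *m u) <= sg ->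
    l1norm (r *m H - t%:M) < rho -> (r *m V *m u) 0 0 = 0.
  move=> Cr rL le_sg lt_H; apply/eqP; apply: contraT => b0; exfalso.
  apply: (NV r _ ((r *m H) 0 0) Cr (VE _ rL)) => //.
  - by apply: le_lt_trans sg_lt; apply: le_trans le_sg; exact: cabs_le_l1norm.
  - exact: mx11_scalar.
  by move: lt_H; rewrite {1}[r *m H]mx11_scalar -raddfB l1norm_scalar.
(* For large [N] no solution touches the boundary of the region. Solutions with coordinate along [v]
   at least [sg] would cluster at a point of the cone where this coordinate is nonzero, which [NV]
   excludes; [Sol_small] controls |z|. *)
have [N0 N0P] : exists N0, forall N s z, (N0 <= N)%N -> Sol N s z ->
    l1norm z < delta /\ l1norm ((x N).2 *: evp f z *m V *m u) < sg.
  have [N1 N1P] := Sol_small delta delta_gt0.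
  apply: contrapT => nex.
  have /boolp.choice[g gP] k : exists g : nat * (R * 'rV[R[i]]_n), [/\ (k <= g.1)%N,
      Sol g.1 g.2.1 g.2.2 & sg <= l1norm ((x g.1).2 *: evp f g.2.2 *m V *m u)].
    apply: contrapT => ng; apply: nex; exists (maxn k N1) => N s z.
    rewrite geq_max => /andP[kN N1N] sol; split; first exact: N1P sol.
    by rewrite ltNge; apply/negP => ge_sg; apply: ng; exists (N, (s, z)).
  have [|k|r [Cr rL le_sg le_H [_ ge_sg]]] :=
      @cluster (fun k => (g k).1) (fun k => (g k).2.1) (fun k => (g k).2.2).
  - by move=> k; have [] := gP k.
  - by have [] := gP k.
  have b0 := absurd r Cr rL le_sg (le_lt_trans le_H ltT).
  have : sg <= l1norm (r *m V *m u) by apply: ge_sg => k; have [] := gP k.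
  by rewrite bE b0 l1norm_scalar cabs0 leNgt sg0.
have VU0 : 0 < mxnorm (V *m u) + 1 by rewrite ltr_wpDl ?mxnorm_ge0.
have [N1 N1P] := invS_small (divr_gt0 sg0 VU0).
have [N2 N2P] := invS_small delta_gt0.
have sol1 k : exists g : nat * 'rV[R[i]]_n, (k <= g.1)%N /\ Sol g.1 1 g.2.
  pose N := maxn (maxn k N0) (maxn N1 N2).
  have [kN N0N] : (k <= N)%N /\ (N0 <= N)%N by rewrite /N !leq_max !leqnn !orbT.
  have [N1N N2N] : (N1 <= N)%N /\ (N2 <= N)%N by rewrite /N !leq_max !leqnn !orbT.
  have [xN1 _ xN0 _] := xP N; pose a := (x N).2.
  pose F := lincomb f V'.
  (* The region in which the segment is lifted. The condition on the coordinate along [v] is written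
     as a bound on a polynomial map, so that closedness and interior points follow from
     continuity. *)
  pose K := [set z | l1norm z <= delta /\ l1norm (evp (lincomb f (a *: (V *m u))) z) <= sg].
  have KE z : evp (lincomb f (a *: (V *m u))) z = a *: evp f z *m V *m u.
    by rewrite evp_lincomb -scalemxAr -!scalemxAl mulmxA.
  pose y1 := evp F (x N).1 + a^-1 *: (D *: v).
  have solE (s : R) z : 0 <= s <= 1 -> K z ->
      evp F z = segment (evp F (x N).1) y1 s -> Sol N s z.
    move=> s01 [zd bu] E; split=> //; first by rewrite -KE.
    have := congr1 (fun y => a *: y) E; rewrite /y1 segmentD scalerDr /F !evp_lincomb.
    rewrite !scalemxAl => ->; congr (_ + _).
    by rewrite !scalerA [a * _]mulrC mulfK.
  have [||||z [zd bu] Fz] := @path_lifting _ _ K F (x N).1 y1 delta.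
  - move=> p' H'; split.
      have := @closed_ball_closed _ _ 0 p' delta; rewrite subr0; apply=> e /H'[z [zd _] lt_z].
      by exists z => //; rewrite subr0.
    apply/ler_addgt0Pr => e e0.
    have [d' d'0 d'P] := evp_continuous (lincomb f (a *: (V *m u))) p' e0.
    have [z [_ bz] lt_z] := H' _ d'0; have := d'P _ lt_z.
    have := l1norm_le_dist (evp (lincomb f (a *: (V *m u))) p') (evp (lincomb f (a *: (V *m u))) z).
    by rewrite l1normBC; move: bz; norm_lra.
  - by move=> z [].
  - split; first by apply: ltW; apply: lt_trans xN1 _; exact: N2P.
    rewrite KE; have -> : a *: evp f (x N).1 *m V *m u = (q N - p) *m (V *m u).
      by rewrite mulmxBl !mulmxA pV wu subr0.
    apply: le_trans (l1norm_mulmx _ _) _.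
    have lt_q : l1norm (q N - p) < sg / (mxnorm (V *m u) + 1).
      exact: lt_trans (qp N) (N1P _ N1N).
    move: lt_q; rewrite ltr_pdivlMr ?ltr_wpDl ?mxnorm_ge0 // => /ltW; apply: le_trans.
    by rewrite ler_wpM2l ?l1norm_ge0 // lerDl.
  - move=> s z s01 Kz E; have [zd bu] := N0P N s z N0N (solE s z s01 Kz E).
    rewrite -/a -KE in bu.
    have gap1 : 0 < delta - l1norm z by rewrite subr_gt0.
    have gap2 : 0 < sg - l1norm (evp (lincomb f (a *: (V *m u))) z) by rewrite subr_gt0.
    have [d' d'0 d'P] := evp_continuous (lincomb f (a *: (V *m u))) z gap2.
    exists (Num.min (delta - l1norm z) d'); first by rewrite lt_min gap1.
    move=> z'; rewrite lt_min => /andP[lt1 /d'P lt2]; split.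
      by have := l1norm_le_dist z' z; move: lt1; norm_lra.
    have := l1norm_le_dist (evp (lincomb f (a *: (V *m u))) z') (evp (lincomb f (a *: (V *m u))) z).
    by move: lt2; norm_lra.
  exists (N, z); split=> //; apply: solE => //; first by rewrite lexx ler01.
  by rewrite Fz /segment rmorph1 scale1r subrKC.
have [g gP] := boolp.choice sol1.
have [k|k|r [Cr rL le_sg le_H [rH _]]] := @cluster (fun k => (g k).1) (fun=> 1) (fun k => (g k).2).
- exact: (gP k).1.
- exact: (gP k).2.
exists r; split=> //; last exact: rH.
by rewrite (VE r rL) (absurd r) ?scale0r ?addr0 //; exact: le_lt_trans le_H ltT.
Qed.

End FibreOpen.

(** * Separating forms and the cardinality of fibres *)

Section Hyperplanes.
Variables (R : realType) (m : nat).

(** [u] is taken on the moment curve u0 + (s, s^2, ..., s^m). The value at it of a nonzero row [x]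
    is a polynomial in [s] with the entries of [x] among its coefficients, so a small [s] avoids all
    roots. *)
Lemma avoid_hyperplanes (u0 : 'cV[R[i]]_m) (es : seq 'rV[R[i]]_m) (e : R) :
  0 < e -> (forall x, x \in es -> x != 0) ->
  exists2 u : 'cV[R[i]]_m, (forall i, cabs (u i 0 - u0 i 0) < e) &
    forall x, x \in es -> (x *m u) 0 0 != 0.
Proof.
move=> e0 es0.
pose pol (x : 'rV[R[i]]_m) : {poly R[i]} :=
  ((x *m u0) 0 0)%:P + \sum_(i < m) x 0 i *: 'X^(i.+1).
pose uu (s : R[i]) : 'cV[R[i]]_m := \col_i (u0 i 0 + s ^+ i.+1).
have polE x s : (pol x).[s] = (x *m uu s) 0 0.
  rewrite /pol hornerD hornerC horner_sum !mxE -big_split; apply: eq_bigr => i _.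
  by rewrite hornerZ hornerXn /= -mulrDr ?mxE.
have pol0 x : x \in es -> pol x != 0.
  move=> /es0; apply: contraNneq => px0; apply/eqP/rowP => i; rewrite mxE.
  have := congr1 (fun p : {poly R[i]} => p`_i.+1) px0.
  rewrite coef0 /pol coefD coefC /= add0r coef_sum (bigD1 i) //= coefZ coefXn eqxx mulr1.
  rewrite big1 ?addr0 // => j nj; rewrite coefZ coefXn.
  case: eqP => [[/val_inj eq_ij]|]; last by rewrite mulr0.
  by rewrite eq_ij eqxx in nj.
have prod0 : \prod_(x <- es) pol x != 0.
  by rewrite prodf_seq_neq0; apply/allP => x /pol0.
have e1 : 0 < Num.min 1 e by rewrite lt_min ltr01.
have [s lt_s ps] := poly_avoid_small prod0 e1.
exists (uu s) => [i|x xes].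
  rewrite mxE addrAC subrr add0r cabsX; move: lt_s; rewrite lt_min => /andP[s1 se].
  apply: le_lt_trans se; rewrite exprS ler_piMr ?cabs_ge0 //.
  by apply: exprn_ile1; rewrite ?cabs_ge0 // ltW.
rewrite -polE; move: ps; rewrite horner_prod prodf_seq_neq0 => /allP; exact.
Qed.

End Hyperplanes.

Lemma poly2_neq0_near (R : realType) (B : {poly {poly R[i]}}) (c0 t0 : R[i]) :
  B.[t0%:P].[c0] != 0 -> exists2 rho : R, 0 < rho & forall c t,
    cabs (c - c0) < rho -> cabs (t - t0) < rho -> B.[t%:P].[c] != 0.
Proof.
move=> B0; pose pt (c t : R[i]) : 'rV[R[i]]_(1 + 1) :=
  row_mx (c%:M : 'M[R[i]]_1) (t%:M : 'M[R[i]]_1).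
pose G : mpoly (1 + 1) R[i] := \sum_(i < size B) \sum_(j < size B`_i)
  B`_i`_j *: (mpolyX R[i] (mnm1 (lshift 1 ord0)) ^+ j * mpolyX R[i] (mnm1 (rshift 1 ord0)) ^+ i).
have GE c t : meval (pt c t 0) G = B.[t%:P].[c].
  rewrite (horner_coef B) horner_sum /G (raddf_sum (meval _)); apply: eq_bigr => i _.
  rewrite hornerM -polyC_exp hornerC horner_coef big_distrl (raddf_sum (meval _)).
  apply: eq_bigr => j _ /=; rewrite mevalZ mevalM !rmorphXn /= !mevalXU.
  by rewrite row_mxEl row_mxEr !mxE !eqxx !mulr1n mulrA.
have n0 : 0 < cabs (meval (pt c0 t0 0) G) by rewrite GE cabs_gt0.
have [d d0 dP] := meval_continuous G (pt c0 t0) n0.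
exists (d / 2); first by rewrite divr_gt0.
move=> c t ltc ltt; rewrite -GE.
have H : cabs (meval (pt c t 0) G - meval (pt c0 t0 0) G) < cabs (meval (pt c0 t0 0) G).
  apply: dP; rewrite /pt opp_row_mx add_row_mx l1norm_row_mx -!raddfB !l1norm_scalar.
  by rewrite (splitr d); apply: ltrD.
by apply: contraTneq H => ->; rewrite sub0r cabsN ltxx.
Qed.

Section FibreCard.
Variables (R : realType) (n m : nat) (f : 'I_m -> mpoly n R[i]).
Variable delta0 : R.
Hypothesis f0 : evp f 0 = 0.
Hypothesis delta0_gt0 : 0 < delta0.
Hypothesis fin : forall z, l1norm z <= delta0 -> evp f z = 0 -> z = 0.

Lemma limit_cone_closed p :
  (forall e, 0 < e -> exists2 q, limit_cone f q & l1norm (q - p) < e) -> limit_cone f p.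
Proof.
move=> H e e0; have e20 : 0 < e / 2 by rewrite divr_gt0.
have [q Cq qp] := H _ e20; have [z [c [lt_z lt_c]]] := Cq _ e20.
exists z, c; split; first by apply: lt_trans lt_z _; rewrite ltr_pdivrMr // ltr_pMr // ltr1n.
by apply: le_lt_trans (l1norm_tri q _ _) _; rewrite (splitr e); apply: ltrD.
Qed.

(** A column of the cokernel of [w] that does not vanish on [v] is rescaled. *)
Lemma dual_vector (v w : 'rV[R[i]]_n) : ~~ (v <= w)%MS ->
  exists2 u : 'cV[R[i]]_n, v *m u = 1%:M & w *m u = 0.
Proof.
rewrite submxE => nz.
have [j] := rV0Pn _ nz; set M := v *m cokermx w => Mj.
exists ((M 0 j)^-1 *: col j (cokermx w)).
  rewrite -scalemxAr colE mulmxA -colE -/M.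
  have -> : col j M = (M 0 j)%:M by rewrite [LHS]mx11_scalar mxE.
  by rewrite scale_scalar_mx mulVf.
by rewrite -scalemxAr colE mulmxA mulmx_coker mul0mx scaler0.
Qed.

(* Otherwise follow a ray from [t] which avoids the roots of [S]: the set of
   values of [H] on the fibre is closed and, along the ray, open, but bounded. *)
Lemma fibre_roots (V : 'M[R[i]]_(m, n)) (v w : 'rV[R[i]]_n) (H : 'cV[R[i]]_m)
    (Q : mpoly (n + 1) R[i]) a (B : {poly {poly R[i]}}) (S : {poly R[i]}) p t :
  reducing f V -> w != 0 -> ~~ (v <= w)%MS -> S != 0 ->
  (forall q, limit_cone f q -> meval (row_mx (q *m V) (q *m H) 0) Q = 0) ->
  (forall t, B.[t%:P].[0] = S.[t]) ->
  (forall c t, meval (row_mx (w + c *: v) (t%:M : 'M[R[i]]_1) 0) Q = c ^+ a * B.[t%:P].[c]) ->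
  limit_cone f p -> p *m V = w -> p *m H = t%:M -> root S t.
Proof.
move=> redV w0 /dual_vector[u vu wu] S0 QC BS QB Cp pV pH.
rewrite /root; apply: contraT => St.
pose S1 := S \Po ('X + t%:P).
have S1E s : S1.[s] = S.[s + t] by rewrite horner_comp !hornerE.
have S10 : S1.[0] != 0 by rewrite S1E add0r.
have [c c1 cP] := poly_avoid_ray S10 ltr01.
have c0 : c != 0.
  by apply: contraTneq c1 => ->; rewrite sub0r cabsN cabs1 ltxx.
have nc0 : 0 < cabs c by rewrite cabs_gt0.
pose E (s : R) := exists q, [/\ limit_cone f q, q *m V = w & q *m H = (t + s%:C * c)%:M].
have [c2 c20 c2P] := reducing_limit_cone redV.
have E_le s : E s -> cabs (t + s%:C * c) <= c2 * l1norm w * mxnorm H.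
  move=> [q [Cq qV qH]]; rewrite -l1norm_scalar -qH; apply: le_trans (l1norm_mulmx _ _) _.
  by rewrite ler_wpM2r ?mxnorm_ge0 // -qV c2P.
have E0 : E 0 by exists p; split=> //; rewrite mul0r addr0.
(* Far enough along the ray for |t + b c| to exceed the bound [E_le] on the values of [H]. *)
pose b := (c2 * l1norm w * mxnorm H + cabs t + 1) / cabs c.
have b0 : 0 <= b.
  by rewrite divr_ge0 ?cabs_ge0 // !addr_ge0 ?cabs_ge0 // !mulr_ge0 ?l1norm_ge0 ?mxnorm_ge0 // ltW.
have : E b.
  apply: (@interval_induction _ E b) => // [s _ Es|s _ [q [Cq qV qH]]].
    have /boolp.choice[x xP] k : exists x : R * 'rV[R[i]]_m, [/\ limit_cone f x.2,
        x.2 *m V = w, x.2 *m H = (t + x.1%:C * c)%:M & `|x.1 - s| < k.+1%:R^-1].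
      have k0 : (0 : R) < k.+1%:R^-1 by rewrite invr_gt0 ltr0n.
      by have [s' [_ [q [Cq qV qH]] lt_s']] := Es _ k0; exists (s', q).
    have [k|q [phi phiP]] := @bolzano_weierstrass _ _ (fun k => (x k).2) (c2 * l1norm w).
      by have [Cx <- _ _] := xP k; exact: c2P.
    have qp j : l1norm ((x (phi j)).2 - q) < j.+1%:R^-1 := (phiP j).2.
    exists q; split.
    - apply: limit_cone_closed => e e0; have [j /(_ j (leqnn _)) lt_j] := invS_small e0.
      exists (x (phi j)).2; first by have [] := xP (phi j).
      exact: lt_trans (qp j) lt_j.
    - apply: (limit_mulmx (C := 0) qp) => j; have [_ -> _ _] := xP (phi j).
      by rewrite subrr l1norm0 mul0r.
    apply: (limit_mulmx (C := cabs c) qp) => j; have [_ _ -> lt_x] := xP (phi j).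
    rewrite -raddfB l1norm_scalar opprD addrACA subrr add0r -mulrBl cabsM mulrC.
    rewrite ler_wpM2l ?cabs_ge0 // -rmorphB cabs_real; apply: le_trans (ltW lt_x) _.
    by rewrite lef_pV2 ?posrE ?ltr0n // ler_nat ltnS (phiP j).1.
  (* As [B] stays nonzero near this point, the equation c^a B = 0 excludes nearby cone points over w
     + c v with c nonzero. This is the isolation hypothesis of [fibre_open]. *)
  have Ssc : B.[(t + s%:C * c)%:P].[0] != 0 by rewrite BS addrC -S1E cP.
  have [rho rho0 rhoP] := poly2_neq0_near Ssc.
  exists (rho / cabs c); first by rewrite divr_gt0.
  move=> s' /andP[ss' s's].
  apply: (@fibre_open _ _ _ _ delta0 f0 delta0_gt0 fin V u v w H (t + s%:C * c) rho) => //.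
  - move=> r b' T Cr rV lt_b b'0 rH lt_T; have := QC r Cr; rewrite rV rH QB => /eqP.
    by rewrite mulf_eq0 expf_eq0 (negPf b'0) andbF (negPf (rhoP _ _ _ lt_T)) // subr0.
  - by exists q.
  rewrite opprD addrACA subrr add0r -mulrBl cabsM -rmorphB cabs_real.
  rewrite -ltr_pdivlMr // ger0_norm ?subr_ge0 //.
  by move: s's; rewrite -ltrBlDl.
move/E_le => le_b; exfalso.
have := cabsD (t + b%:C * c) (- t); rewrite addrAC subrr add0r cabsN cabsM cabs_real.
rewrite ger0_norm // {1}/b divfK ?gt_eqF // => le1.
have := le_trans le1 (_ : _ <= c2 * l1norm w * mxnorm H + cabs t).
by rewrite lerD2r => /(_ le_b); rewrite gerDl ler10.
Qed.

(** A form [H] separates the points, and its values on them are roots of one nonzero polynomial [S],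
    whose degree is bounded by the degree of the relation in its last variable. *)
Lemma fibre_card d (V : 'M[R[i]]_(m, n)) (w : 'rV[R[i]]_n) (ps : seq 'rV[R[i]]_m) :
  (0 < d)%N -> (forall i, (msize (f i) <= d.+1)%N) ->
  reducing f V -> w != 0 -> uniq ps ->
  (forall p, p \in ps -> limit_cone f p /\ p *m V = w) -> (size ps <= d ^ n)%N.
Proof.
move=> d_gt0 le_d redV w0 ps_uniq psP.
have [H _ HP] := @avoid_hyperplanes R m 0 [seq x - y | x <- ps, y <- [seq y <- ps | y != x]] 1 ltr01
  ltac:(by move=> _ /allpairsPdep[x [y [_ + ->]]];
           rewrite mem_filter => /andP[nyx _]; rewrite subr_eq0 eq_sym).
have [P [P0 degP Pf]] :=
  algebraic_relation d_gt0 (leqnn n) (fun j => msize_lincomb (row_mx V H) j le_d).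
have [z|s [Q [Q0 QP Qhom QC]]] := @tangent_form _ _ _ f f0 _ (row_mx V H) P P0.
  rewrite -[RHS](Pf (z 0)); apply: meval_eq => j.
  by rewrite -evp_lincomb mxE.
have degQ mo : mo \in msupp Q -> (mo (rshift n ord0) <= d ^ n)%N.
  by move=> /QP; exact: degP.
have {}QC q : limit_cone f q -> meval (row_mx (q *m V) (q *m H) 0) Q = 0.
  by move=> /QC; rewrite mul_mx_row.
have [S [S0 sizeS rootS]] : exists S : {poly R[i]}, [/\ S != 0, (size S <= (d ^ n).+1)%N &
    forall p t, limit_cone f p -> p *m V = w -> p *m H = t%:M -> root S t].
  (* If [Q] does not vanish identically over [w], the constant line (direction 0) suffices, and no
     positive power of the line coordinate can have been taken out. *)
  have [[t0 Qt0]|nQ] := pselect (exists t : R[i], meval (row_mx w (t%:M : 'M[R[i]]_1) 0) Q != 0).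
    have [|a [B [S [S0 sizeS BS QB]]]] := @restrict_to_line _ _ _ Q w 0 degQ.
      by exists 0, t0; rewrite scaler0 addr0.
    have QS t : meval (row_mx w (t%:M : 'M[R[i]]_1) 0) Q = 0 ^+ a * S.[t].
      by rewrite -BS -QB scaler0 addr0.
    have a0 : (0 : R[i]) ^+ a = 1.
      move: Qt0; rewrite QS; case: (a) => [|a']; rewrite ?expr0 //.
      by rewrite expr0n mul0r eqxx.
    exists S; split=> // p t Cp pV pH; have := QC p Cp.
    by rewrite pV pH QS a0 mul1r => /eqP.
  have Qw t : meval (row_mx w (t%:M : 'M[R[i]]_1) 0) Q = 0.
    by apply/eqP; apply: contraT => Qt; case: nQ; exists t.
  have Qcw c t : c != 0 -> meval (row_mx (c *: w) (t%:M : 'M[R[i]]_1) 0) Q = 0.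
    move=> c0; have := Qhom c (row_mx w ((c^-1 * t)%:M : 'M[R[i]]_1)).
    by rewrite Qw mulr0 scale_row_mx scale_scalar_mx mulrA mulfV // mul1r.
  have [v' Qv'] := mpoly_neq0_meval Q0.
  pose y : 'rV[R[i]]_n := \row_j v' (lshift 1 j).
  pose t0 := v' (rshift n ord0).
  have Qy : meval (row_mx y (t0%:M : 'M[R[i]]_1) 0) Q != 0.
    have <- : meval v' Q = meval (row_mx y (t0%:M : 'M[R[i]]_1) 0) Q; last exact: Qv'.
    apply: meval_eq => j; rewrite -(splitK j).
    case: (fintype.split j) => i /=; rewrite ?row_mxEl ?row_mxEr !mxE //.
    by rewrite (ord1 i) eqxx mulr1n.
  (* By homogeneity [Q] vanishes over all nonzero multiples of [w], and by continuity over 0 as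
     well. So [y], over which [Q] does not vanish, is off the line of [w]. *)
  have ny : ~~ (y <= w)%MS.
    apply/negP => /sub_rVP[c yc]; have [c0|c0] := eqVneq c 0; last first.
      by move: Qy; rewrite yc Qcw ?eqxx.
    have n0 : 0 < cabs (meval (row_mx y (t0%:M : 'M[R[i]]_1) 0) Q) by rewrite cabs_gt0.
    have [e e0 eP] := meval_continuous Q (row_mx y (t0%:M : 'M[R[i]]_1)) n0.
    have nw0 : 0 < l1norm w + 1 by rewrite ltr_wpDl ?l1norm_ge0.
    pose c' := (e / (l1norm w + 1))%:C.
    have c'0 : c' != 0 by rewrite -cabs_gt0 cabs_real normr_gt0 gt_eqF // divr_gt0.
    have := eP (row_mx (c' *: w) (t0%:M : 'M[R[i]]_1)).
    rewrite Qcw // sub0r cabsN ltxx => H'.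
    have : false; last by [].
    apply: H'.
    rewrite opp_row_mx add_row_mx l1norm_row_mx subrr l1norm0 addr0 yc c0 scale0r subr0 l1normZ cabs_real.
    rewrite ger0_norm ?divr_ge0 ?(ltW e0) ?(ltW nw0) // mulrAC ltr_pdivrMr //.
    by rewrite ltr_pM2l // ltrDl.
  have nv : ~~ (y - w <= w)%MS.
    by apply: contra ny => le_v; rewrite -[y](subrK w) addmx_sub.
  have [|a [B [S [S0 sizeS BS QB]]]] := @restrict_to_line _ _ _ Q w (y - w) degQ.
    by exists 1, t0; rewrite scale1r subrKC.
  exists S; split=> // p t Cp pV pH.
  exact: (@fibre_roots V (y - w) w H Q a B S p t).
pose h (p : 'rV[R[i]]_m) := (p *m H) 0 0.
have h_inj : {in ps &, injective h}.
  move=> x y xps yps eq_h; apply/eqP; apply: contraT => nxy.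
  have : (x - y) \in [seq x - y | x <- ps, y <- [seq y <- ps | y != x]].
    by apply/allpairsPdep; exists x, y; split=> //; rewrite mem_filter eq_sym nxy.
  by move=> /HP; rewrite mulmxBl !mxE; rewrite /h !mxE in eq_h; rewrite eq_h subrr eqxx.
have := @max_poly_roots _ S (map h ps) S0; rewrite map_inj_in_uniq // size_map => H'.
rewrite -ltnS; apply: leq_trans sizeS; apply: H' => //.
apply/allP => _ /mapP[p pps ->]; have [Cp pV] := psP p pps.
by apply: (rootS p) => //; exact: mx11_scalar.
Qed.

End FibreCard.

(** * Choosing the linear forms *)

Local Close Scope classical_set_scope.

Lemma subset_of_card (T : finType) (A : {set T}) r : (r <= #|A|)%N ->
  exists2 B : {set T}, B \subset A & #|B| = r.
Proof.
move=> le_r; exists [set x in take r (enum A)].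
  by apply/fintype.subsetP => x; rewrite inE => /mem_take; rewrite mem_enum.
rewrite cardsE (card_uniqP _) ?take_uniq ?enum_uniq // size_takel //.
by rewrite -cardE.
Qed.

Section Perturbation.
Variables (R : realType) (n m : nat) (f : 'I_m -> mpoly n R[i]).

Definition set_col (V : 'M[R[i]]_(m, n)) (j0 : 'I_n) (u : 'cV[R[i]]_m) : 'M[R[i]]_(m, n) :=
  \matrix_(i, j) if j == j0 then u i 0 else V i j.

Lemma mulmx_set_col V j0 u (p : 'rV[R[i]]_m) j :
  (p *m set_col V j0 u) 0 j = if j == j0 then (p *m u) 0 0 else (p *m V) 0 j.
Proof.
by rewrite !mxE; case: eqP => [->|/eqP nj]; apply: eq_bigr => i _; rewrite mxE ?eqxx ?(negPf nj).
Qed.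

Lemma mxnorm_set_col (V : 'M[R[i]]_(m, n)) j0 (u : 'cV[R[i]]_m) (e : R) :
  (forall i, cabs (u i 0 - V i j0) <= e) ->
  mxnorm (set_col V j0 u - V) <= m%:R * e.
Proof.
move=> le_e; rewrite -[m in m%:R]card_ord mulr_natl -sumr_const.
apply: ler_sum => i _; rewrite /l1norm (bigD1 j0) //= big1 ?addr0 => [|j nj].
  by rewrite !mxE eqxx.
by rewrite !mxE (negPf nj) subrr cabs0.
Qed.

(** The last [q] columns are moved one by one. Each new column is nonzero on some vector of every
    nonzero [E], which lowers the rank of the part of [E] that it kills; after [q] steps nothing is
    left. The moves are small enough for [V] to stay reducing. *)
Lemma generic_perturbation q (Es : seq 'M[R[i]]_m) (V : 'M[R[i]]_(m, n)) :
  (q <= n)%N -> reducing f V -> (forall E, E \in Es -> (\rank E <= q)%N) ->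
  exists V' : 'M[R[i]]_(m, n), [/\ reducing f V',
    forall j : 'I_n, (j < n - q)%N -> col j V' = col j V &
    forall E (p : 'rV[R[i]]_m), E \in Es -> (p <= E)%MS ->
      (forall j : 'I_n, (n - q <= j)%N -> (p *m V') 0 j = 0) -> p = 0].
Proof.
elim: q Es V => [|q IHq] Es V le_q redV rkE.
  exists V; split=> // E p /rkE; rewrite leqn0 mxrank_eq0 => /eqP-> p0 _.
  by apply/eqP; rewrite -submx0.
have j0_lt : (n - q.+1 < n)%N by lia.
pose j0 := Ordinal j0_lt.
have [e e0 eP] := reducing_open redV.
have e10 : 0 < e / (m.+1)%:R by rewrite divr_gt0 ?ltr0n.
have [x|u u_near uP] := @avoid_hyperplanes R m (col j0 V) [seq nz_row E | E <- Es & E != 0] _ e10.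
  by move=> /mapP[E]; rewrite mem_filter => /andP[E0 _ ->]; rewrite nz_row_eq0.
pose V1 := set_col V j0 u.
have redV1 : reducing f V1.
  apply: eP; apply: le_lt_trans (_ : m%:R * (e / m.+1%:R) < e).
    apply: mxnorm_set_col => i; have := u_near i; rewrite mxE; exact: ltW.
  by rewrite mulrCA -[ltRHS]mulr1 ltr_pM2l // ltr_pdivrMr ?ltr0n // mul1r ltr_nat.
pose Es' := [seq (E :&: kermx u)%MS | E <- Es].
have [|E'|V' [redV' V'V V'P]] := IHq Es' V1 _ redV1.
- exact: ltnW.
- move=> /mapP[E EEs ->]; have [E0|E0] := eqVneq E 0.
    by rewrite E0 cap0mx mxrank0.
  rewrite -ltnS; apply: leq_trans (rkE _ EEs); apply: rank_ltmx.
  rewrite ltmxE capmxSl /=; apply/negP => le_E.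
  have := submx_trans (nz_row_sub E) le_E; rewrite sub_capmx => /andP[_ /sub_kermxP Eu].
  have := uP (nz_row E); rewrite Eu mxE eqxx => H.
  suff : false by []; apply: H; apply: map_f; by rewrite mem_filter E0.
exists V'; split=> // [j lt_j|E p EEs pE pV'].
  rewrite V'V; last by lia.
  apply/colP => i; rewrite !mxE ifN //; apply: contraTneq lt_j => -> /=.
  by rewrite ltnn.
have pu : p *m u = 0.
  have := pV' j0 (leqnn _).
  have -> : (p *m V') 0 j0 = (p *m V1) 0 j0.
    have lt0 : (j0 < n - q)%N by rewrite /=; lia.
    have eqc := V'V j0 lt0; rewrite [LHS]mxE [RHS]mxE; apply: eq_bigr => i _.
    by have := congr1 (fun c : 'cV[R[i]]_m => c i 0) eqc; rewrite 2!mxE => ->.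
  rewrite mulmx_set_col eqxx => pu0.
  by rewrite [LHS]mx11_scalar pu0 raddf0.
apply: (V'P (E :&: kermx u)%MS) => [||j le_j]; first exact: map_f.
  by rewrite sub_capmx pE; apply/sub_kermxP.
by apply: pV'; lia.
Qed.

End Perturbation.

Definition common_kernel (K : fieldType) (m l : nat) (L : 'I_l -> 'cV[K]_m)
    (T : {set 'I_l}) : 'M[K]_m :=
  kermx (\matrix_(i < m, s < #|T|) L (enum_val s) i 0).

Lemma sub_common_kernel (K : fieldType) (m l : nat) (L : 'I_l -> 'cV[K]_m)
    (T : {set 'I_l}) (p : 'rV[K]_m) :
  (p <= common_kernel L T)%MS <-> (forall t, t \in T -> p *m L t = 0).
Proof.
split=> [/sub_kermxP pT t tT|pT].
  have := congr1 (fun x : 'rV_#|T| => x 0 (enum_rank_in tT t)) pT.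
  rewrite [LHS]mxE [RHS]mxE => E; rewrite [LHS]mx11_scalar.
  rewrite -[RHS](raddf0 (@scalar_mx K 1)); congr (_%:M).
  rewrite mxE -[RHS]E; apply: eq_bigr => i _.
  by rewrite mxE enum_rankK_in.
apply/sub_kermxP/rowP => s; rewrite [LHS]mxE [RHS]mxE.
have := congr1 (fun x : 'rV_1 => x 0 0) (pT _ (enum_valP s)); rewrite [LHS]mxE [RHS]mxE.
by move=> E; rewrite -[RHS]E; apply: eq_bigr => i _; rewrite mxE.
Qed.

(** Completing [T] to [m] forms by a set [U] of m - |T| others leaves no common zero, so the forms
    in [U] embed the common kernel of [T] into a space of dimension m - |T|. *)
Lemma rank_common_kernel (K : fieldType) (m l : nat) (L : 'I_l -> 'cV[K]_m)
    (T : {set 'I_l}) : (m <= l)%N -> (#|T| <= m)%N ->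
  (forall S : {set 'I_l}, #|S| = m -> forall p : 'rV[K]_m,
     (forall t, t \in S -> p *m L t = 0) -> p = 0) ->
  (\rank (common_kernel L T) <= m - #|T|)%N.
Proof.
move=> le_ml le_T indep.
have [U UT cardU] : exists2 U : {set 'I_l}, U \subset ~: T & #|U| = (m - #|T|)%N.
  apply: subset_of_card; rewrite -(leq_add2l #|T|) cardsC card_ord.
  by rewrite subnKC.
pose A : 'M[K]_(m, #|U|) := \matrix_(i, s) L (enum_val s) i 0.
have cap0 : (common_kernel L T :&: kermx A)%MS = 0.
  apply/eqP/rowV0P => p; rewrite sub_capmx => /andP[/sub_common_kernel pT].
  rewrite -/(common_kernel L U) => /sub_common_kernel pU.
  apply: (indep (T :|: U)).
    rewrite cardsU cardU; have -> : T :&: U = finset.set0.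
      by apply/eqP; rewrite finset.setI_eq0 disjoint_sym finset.disjoints_subset.
    by rewrite cards0 subn0 subnKC.
  by move=> t; rewrite inE => /orP[/pT|/pU].
by rewrite -(mxrank_mul_ker _ A) cap0 mxrank0 addn0 -cardU rank_leq_col.
Qed.

Lemma pigeonhole (T : finType) (U : eqType) (A : {set T}) (g : T -> U) (s : seq U) k :
  uniq s -> (forall t, t \in A -> g t \in s) -> (size s * k < #|A|)%N ->
  exists x, (k < #|[set t in A | g t == x]|)%N.
Proof.
move=> s_uniq gs lt_A; apply: contrapT => nex.
have le_k x : (#|[set t in A | g t == x]| <= k)%N.
  by rewrite leqNgt; apply/negP => lt_k; apply: nex; exists x.
have : (#|A| <= size s * k)%N.
  apply: (@leq_trans (\sum_(x <- s) #|[set t in A | g t == x]|)).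
    under eq_bigr do rewrite -sum1_card big_mkcond.
    rewrite -sum1_card big_mkcond exchange_big /=; apply: leq_sum => t _.
    case: ifP => // tA; rewrite (bigD1_seq (g t)) ?gs //=.
    by rewrite inE tA eqxx.
  apply: leq_trans (leq_sum _ (fun x _ => le_k x)) _.
  by rewrite big_const_seq count_predT iter_addn_0 mulnC.
by rewrite leqNgt lt_A.
Qed.

Section Selection.
Variables (R : realType) (n m d l : nat) (f : 'I_m -> mpoly n R[i]).
Variable delta0 : R.
Hypothesis f0 : evp f 0 = 0.
Hypothesis delta0_gt0 : 0 < delta0.
Hypothesis fin : forall z, l1norm z <= delta0 -> evp f z = 0 -> z = 0.
Hypothesis n_gt0 : (0 < n)%N.
Hypothesis d_gt0 : (0 < d)%N.
Hypothesis le_nm : (n <= m)%N.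
Hypothesis le_d : forall i, (msize (f i) <= d.+1)%N.
Variable L : 'I_l -> 'cV[R[i]]_m.
Hypothesis le_ml : (m <= l)%N.
Hypothesis indep : forall S : {set 'I_l}, #|S| = m -> forall p : 'rV[R[i]]_m,
  (forall t, t \in S -> p *m L t = 0) -> p = 0.

(** If no form outside [I] could replace column [j0], each would vanish at a cone point over the
    [j0]-th basis vector. There are at most d^n such points, and more than d^n (m - n) forms outside
    [I], so m - n + 1 of them vanish at the same point; together with [I] these are too many. *)
Lemma exchange_column (V : 'M[R[i]]_(m, n)) (j0 : 'I_n) (I : {set 'I_l}) :
  reducing f V -> #|I| = j0 -> (d ^ n * (m - n) + n <= l)%N ->
  (forall t, t \in I -> exists2 j : 'I_n, (j < j0)%N & col j V = L t) ->
  exists (V' : 'M[R[i]]_(m, n)) t, [/\ reducing f V', t \notin I,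
    forall j : 'I_n, (j < j0)%N -> col j V' = col j V & col j0 V' = L t].
Proof.
move=> redV cardI le_l IV.
(* The [j0] forms of [I] plus m - n + 1 further ones. The common kernel of [r] of the forms has rank
   at most n - j0 - 1, the number of columns after [j0], which are made generic with respect to all
   these kernels. *)
pose r := (m - n + j0.+1)%N.
have lt_j0 := ltn_ord j0.
pose Es := [seq common_kernel L T | T <- enum [set T : {set 'I_l} | #|T| == r]].
have [|E|V1 [redV1 V1V V1P]] := @generic_perturbation R n m f (n - j0.+1) Es V _ redV.
- by lia.
- case/mapP => T; rewrite mem_enum inE => /eqP cardT ->.
  apply: leq_trans (rank_common_kernel le_ml _ indep) _; rewrite cardT /r; lia.
have j0E : (n - (n - j0.+1) = j0.+1)%N by lia.
rewrite j0E in V1V V1P.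
apply: contrapT => nex.
(* For [t] in [I] the value 0 is only a filler. Otherwise the witness of failure is scaled to have
   [j0]-th coordinate 1, which is possible because the other columns kill it and [V1] is
   reducing. *)
have bad t : exists p, t \notin I ->
    [/\ limit_cone f p, p *m V1 = delta_mx 0 j0 & p *m L t = 0].
  have [tI|tI] := boolP (t \in I); first by exists 0.
  have nred : ~ reducing f (set_col V1 j0 (L t)).
    move=> redV'; apply: nex; exists (set_col V1 j0 (L t)), t; split=> //.
      move=> j lt_j; rewrite -V1V; last by lia.
      by apply/colP => i; rewrite !mxE ifN //; apply: contraTneq lt_j => ->; rewrite ltnn.
    by apply/colP => i; rewrite !mxE eqxx.
  have [p [Cp p0 pV']] := not_reducing nred.
  have pj j : (if j == j0 then (p *m L t) 0 0 else (p *m V1) 0 j) = 0.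
    by rewrite -mulmx_set_col pV' mxE.
  have pL : p *m L t = 0.
    by rewrite [LHS]mx11_scalar; have := pj j0; rewrite eqxx => ->; rewrite raddf0.
  pose c := (p *m V1) 0 j0.
  have pV1 : p *m V1 = c *: delta_mx 0 j0.
    apply/rowP => j; rewrite [RHS]mxE [delta_mx _ _ _ _]mxE eqxx /=.
    have := pj j; have [->|nj] := eqVneq j j0; first by rewrite mulr1.
    by rewrite mulr0.
  have c0 : c != 0.
    have [c1 c10 /(_ p Cp)] := reducing_limit_cone redV1.
    rewrite pV1; apply: contraTneq => ->; rewrite scale0r l1norm0 mulr0 -ltNge.
    by rewrite l1norm_gt0.
  exists (c^-1 *: p) => _; split.
  - exact: limit_coneZ.
  - by rewrite -scalemxAl pV1 scalerA mulVf // scale1r.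
  - by rewrite -scalemxAl pL scaler0.
have [g gP] := boolp.choice bad.
pose ps := undup [seq g t | t <- enum (~: I)].
have psP p : p \in ps -> limit_cone f p /\ p *m V1 = delta_mx 0 j0.
  rewrite mem_undup => /mapP[t]; rewrite mem_enum inE => /gP[Cg gV _] ->.
  by split.
have w0 : (delta_mx 0 j0 : 'rV[R[i]]_n) != 0.
  by apply/rV0Pn; exists j0; rewrite mxE !eqxx oner_eq0.
have card_ps : (size ps <= d ^ n)%N.
  exact: (fibre_card f0 delta0_gt0 fin d_gt0 le_d redV1 w0 (undup_uniq _) psP).
have [|||v lt_v] := @pigeonhole _ _ (~: I) g ps (m - n).
- exact: undup_uniq.
- by move=> t tI; rewrite mem_undup; apply: map_f; rewrite mem_enum.
- have := cardsC I; rewrite card_ord cardI => cardIC.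
  apply: leq_ltn_trans (_ : d ^ n * (m - n) < _)%N; first by rewrite leq_mul2r card_ps orbT.
  by lia.
have [S SI cardS] := subset_of_card lt_v.
have SP t : t \in S -> t \notin I /\ g t = v.
  by move/(fintype.subsetP SI); rewrite !inE => /andP[tI /eqP].
have [t tS] : exists t, t \in S by apply/finset.set0Pn; rewrite -card_gt0 cardS.
have [tI gt] := SP t tS; have [_ vV _] := gP t tI; rewrite gt in vV.
(* [v] is killed by the [r] forms of [I :|: S] and by the generic columns after [j0]. *)
have v0 : v = 0.
  apply: (V1P (common_kernel L (I :|: S))).
  - apply: map_f; rewrite mem_enum inE cardsU cardI cardS.
    have -> : I :&: S = finset.set0.
      apply/finset.setP => x; rewrite !inE; apply/negP => /andP[xI /SP[]].
      by rewrite xI.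
    by rewrite cards0 subn0 /r; apply/eqP; lia.
  - apply/sub_common_kernel => x; rewrite inE => /orP[xI|/SP[xI <-]]; last first.
      by have [] := gP x xI.
    have [j lt_j <-] := IV x xI; rewrite -V1V; last by lia.
    rewrite colE mulmxA vV -colE; apply/matrixP => a b; rewrite !mxE andbC.
    by case: eqP lt_j => [->|//]; rewrite ltnn.
  - move=> j lt_j; rewrite vV mxE andbC.
    by case: eqP lt_j => [->|//]; rewrite ltnn.
by move: w0; rewrite -vV v0 mul0mx eqxx.
Qed.

Lemma reducing_selection : (d ^ n * (m - n) + n <= l)%N ->
  exists (V : 'M[R[i]]_(m, n)) (i : 'I_n -> 'I_l),
    [/\ reducing f V, injective i & forall j, col j V = L (i j)].
Proof.
move=> le_l.
have l0 : 'I_l by apply: (@Ordinal _ 0); lia.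
(* The indices form a function on [nat], so that its type does not change with [k]; beyond [k] its
   values are irrelevant, and [l0] serves as the initial one. *)
suff H k : (k <= n)%N -> exists (V : 'M[R[i]]_(m, n)) (i : nat -> 'I_l),
    [/\ reducing f V, {in [pred x | (x < k)%N] &, injective i}
      & forall j : 'I_n, (j < k)%N -> col j V = L (i j)].
  have [V [i [redV i_inj Vi]]] := H n (leqnn n).
  exists V, (fun j => i j); split=> // [j1 j2 eq_i|j]; last exact: Vi.
  by apply/val_inj/i_inj; rewrite ?inE ?ltn_ord.
elim: k => [|k IHk] lt_k.
  have [V redV] := noether_normalisation f0 le_nm.
  by exists V, (fun=> l0); split.
have [V [i [redV i_inj Vi]]] := IHk (ltnW lt_k).
pose j0 := Ordinal lt_k.
pose I := [set i (val j) | j : 'I_k].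
have cardI : #|I| = j0.
  rewrite card_imset ?card_ord // => j1 j2 eq_i.
  by apply/val_inj/i_inj; rewrite ?inE ?ltn_ord.
have [|V' [t [redV' tI V'V V't]]] := exchange_column redV cardI le_l.
  move=> t /imsetP[j _ ->]; have lt_j : (j < n)%N by exact: ltn_trans (ltn_ord j) lt_k.
  by exists (Ordinal lt_j); rewrite ?(Vi (Ordinal lt_j)) /=.
have iI (j : nat) : (j < k)%N -> i j \in I.
  by move=> lt_j; apply/imsetP; exists (Ordinal lt_j).
exists V', (fun j => if j == k then t else i j); split=> //.
- move=> j1 j2; rewrite !inE !ltnS => le1 le2.
  case: eqP => [->|/eqP n1]; case: eqP => [->|/eqP n2] //.
  + by move=> eq_t; rewrite eq_t iI // ltn_neqAle n2 in tI.
  + by move=> eq_t; rewrite -eq_t iI // ltn_neqAle n1 in tI.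
  by apply: i_inj; rewrite inE ltn_neqAle ?n1 ?n2.
- move=> j; rewrite ltnS leq_eqVlt; case: eqP => [jk _|/eqP nj /= lt_j].
    by rewrite -V't; congr (col _ _); apply: val_inj.
  by rewrite V'V // Vi.
Qed.

End Selection.

Local Open Scope classical_set_scope.
Local Open Scope ring_scope.

(** * From the Euclidean norm, neighbourhoods and linear forms of the statement to the l1 norm and
    matrices *)

Section Reformulation.
Variable R : realType.

Lemma cabs_le_enorm n (z : 'rV[R[i]]_n) k : cabs (z 0 k) <= enorm z.
Proof.
rewrite /enorm -[leLHS]ger0_norm ?cabs_ge0 // -sqrtr_sqr ler_sqrt.
  by rewrite (bigD1 k) //= lerDl sumr_ge0 // => j _; exact: sqr_ge0.
by rewrite sumr_ge0 // => j _; exact: sqr_ge0.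
Qed.

Lemma l1norm_le_enorm n (z : 'rV[R[i]]_n) : l1norm z <= n%:R * enorm z.
Proof. by apply: l1norm_le_const => k; exact: cabs_le_enorm. Qed.

Lemma enorm_le_l1norm n (z : 'rV[R[i]]_n) : enorm z <= l1norm z.
Proof.
rewrite /enorm -[leRHS]ger0_norm ?l1norm_ge0 // -sqrtr_sqr ler_sqrt ?sqr_ge0 //.
rewrite expr2 {2}/l1norm big_distrr /=; apply: ler_sum => k _.
by rewrite expr2 ler_wpM2r ?cabs_ge0 // cabs_le_l1norm.
Qed.

Lemma enorm_ge0 n (z : 'rV[R[i]]_n) : 0 <= enorm z.
Proof. exact: sqrtr_ge0. Qed.

Lemma nbhs0_l1norm n (A : set (Cvec R n)) :
  nbhs (0 : Cvec R n) A <-> exists2 e : R, 0 < e & forall z, l1norm z < e -> A z.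
Proof.
split=> [/nbhs_ballP[e e0 eA]|[e e0 eA]].
  (* The radius of a ball over R[i] is itself a complex number; being positive, it is real. *)
  have eE : e = (complex.Re e)%:C.
    by move: e0; rewrite /= ltcE => /andP[/eqP /= im0 _]; case: (e) im0 => a b /= ->.
  exists (complex.Re e); first by move: e0; rewrite /= {1}eE ltcR.
  move=> z lt_z; apply: eA; split=> // a j; rewrite ord1 /ball /= mxE sub0r normrN eE.
  by rewrite ltcR; apply: le_lt_trans (cabs_le_l1norm _ _) lt_z.
have n0 : (0 : R) < n.+1%:R by rewrite ltr0n.
apply/nbhs_ballP; exists (e / n.+1%:R)%:C; first by rewrite /= ltcR divr_gt0.
move=> z [_ bz]; apply: eA; apply: le_lt_trans (_ : n%:R * (e / n.+1%:R) < e).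
  apply: l1norm_le_const => k; have := bz 0 k; rewrite /ball /= mxE sub0r normrN ltcR.
  exact: ltW.
by rewrite mulrCA -[ltRHS]mulr1 ltr_pM2l // ltr_pdivrMr // mul1r ltr_nat.
Qed.

Definition form_col m (L : linform R m) : 'cV[R[i]]_m := \col_i L (delta_mx 0 i).

Lemma form_colE m (L : linform R m) (w : 'rV[R[i]]_m) : L w = (w *m form_col L) 0 0.
Proof.
rewrite {1}(row_sum_delta w) linear_sum mxE; apply: eq_bigr => i _.
by rewrite linearZ mxE.
Qed.

(** A nonzero common zero of [m] forms makes their square matrix singular; a kernel vector of the
    transpose is then a nontrivial linear relation between the forms. *)
Lemma independent_kernel m l (L : 'I_l -> linform R m) : independent L ->
  forall S : {set 'I_l}, #|S| = m -> forall p : 'rV[R[i]]_m,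
  (forall t, t \in S -> p *m form_col (L t) = 0) -> p = 0.
Proof.
move=> [_ freeL] S cardS p pS.
pose i (k : 'I_m) : 'I_l := enum_val (cast_ord (esym cardS) k).
have i_inj : injective i by move=> j k /enum_val_inj/cast_ord_inj.
have iS k : i k \in S by exact: enum_valP.
have /freeP freeX := freeL i i_inj : free [tuple L (i k) | k < m].
pose A : 'M[R[i]]_m := \matrix_(a, k) form_col (L (i k)) a 0.
apply/eqP; apply: contraT => p0.
have : \det A == 0.
  apply/det0P; exists p => //; apply/rowP => k; rewrite !mxE.
  have := congr1 (fun x : 'rV_1 => x 0 0) (pS _ (iS k)); rewrite !mxE => E.
  by rewrite -[RHS]E; apply: eq_bigr => a _; rewrite !mxE.
rewrite -det_tr => /det0P[c c0 cA].
have : \sum_(k < m) c 0 k *: [tuple L (i k) | k < m]`_k = 0.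
  apply/lfunP => w; rewrite sum_lfunE zero_lfunE.
  under eq_bigr do rewrite scale_lfunE -tnth_nth tnth_mktuple form_colE.
  transitivity ((w *m (c *m A^T)^T) 0 0); last by rewrite cA trmx0 mulmx0 mxE.
  rewrite trmx_mul trmxK mulmxA [RHS]mxE; apply: eq_bigr => k _.
  by rewrite [c^T _ _]mxE mulrC; congr (_ * _); rewrite !mxE; apply: eq_bigr => a _; rewrite !mxE.
move=> /freeX cz; case/eqP: c0; apply/rowP => k; rewrite cz.
by rewrite mxE.
Qed.

End Reformulation.

(** Every exponent admissible for [g'] is admissible for [g], with its constant divided by [c]. *)
Lemma loja_le (R : realType) (n k k' : nat) (g : Cvec R n -> Cvec R k)
    (g' : Cvec R n -> Cvec R k') (c : R) : 0 < c ->
  (\forall z \near (0 : Cvec R n), enorm (g' z) <= c * enorm (g z)) ->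
  (loja g <= loja g')%E.
Proof.
move=> c0 le_g; apply: le_ereal_inf => _ [nu [nu1 [a a0 le_a]] <-].
exists nu => //; split=> //; exists (a / c); first exact: divr_gt0.
apply: filterS2 le_g le_a => z le_g le_a.
by rewrite mulrAC ler_pdivrMr // [leRHS]mulrC (le_trans le_a).
Qed.

Theorem corollary5p3 (R : realType) (m n d l : nat)
    (hn : (0 < n)%N) (hd : (0 < d)%N) (hmn : (n <= m)%N)
    (hl : l = (d ^ n * (m - n) + n)%N)
    (L : 'I_l -> linform R m) (hL : independent L)
    (f : 'I_m -> mpoly n (complex R))
    (hf0 : polymap f 0 = 0)
    (hfin : finite_at0 (polymap f))
    (hdeg : (deg_polymap f <= d)%N) :
  loja (polymap f) =
  \big[Order.min/+oo%E]_(i : n.-tuple 'I_l | sorted ltn (map val i))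
    loja (linmap L i \o polymap f).
Proof.
have linmapE (i : n.-tuple 'I_l) (w : 'rV[R[i]]_m) k :
    linmap L i w 0 k = (w *m form_col (L (tnth i k))) 0 0.
  by rewrite mxE form_colE.
apply/eqP; rewrite eq_le; apply/andP; split.
  (* Any choice of forms is a bounded linear map, so composing with it can only increase the
     exponent. *)
  apply: le_bigmin => [|i _]; first exact: leey.
  pose W : 'M[R[i]]_(m, n) := \matrix_(a, k) form_col (L (tnth i k)) a 0.
  have WE w : linmap L i w = w *m W.
    apply/rowP => k; rewrite linmapE [LHS]mxE [RHS]mxE; apply: eq_bigr => a _.
    by rewrite [W _ _]mxE.
  have c0 : 0 < m%:R * mxnorm W + 1 by rewrite ltr_wpDl // mulr_ge0 ?ler0n ?mxnorm_ge0.
  apply: (loja_le c0); apply/nbhs0_l1norm; exists 1 => // z _ /=.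
  apply: le_trans (enorm_le_l1norm _) _; rewrite WE; apply: le_trans (l1norm_mulmx _ _) _.
  have := l1norm_le_enorm (polymap f z); set e := enorm _ => le_e.
  apply: (@le_trans _ _ (m%:R * e * mxnorm W)); first by rewrite ler_wpM2r ?mxnorm_ge0.
  by rewrite mulrAC ler_wpM2r ?enorm_ge0 // lerDl.
have f0 : evp f 0 = 0 by exact: hf0.
have [delta delta_gt0 fin] : exists2 e : R, 0 < e &
    forall z, l1norm z <= e -> evp f z = 0 -> z = 0.
  have [_ [A /nbhs0_l1norm[e e0 eA] AE]] := hfin.
  (* Half the radius, since a closed ball is required. *)
  exists (e / 2); first by rewrite divr_gt0.
  move=> z le_z fz0; have : (A `&` polymap f @^-1` [set 0]) z.
    by split=> //; apply: eA; apply: le_lt_trans le_z _; rewrite ltr_pdivrMr // ltr_pMr // ltr1n.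
  by rewrite AE.
have le_d j : (msize (f j) <= d.+1)%N.
  have : ((msize (f j)).-1 <= d)%N.
    by apply: leq_trans hdeg; exact: (leq_bigmax (F := fun j => (msize (f j)).-1)).
  by case: (msize (f j)).
have le_l : (d ^ n * (m - n) + n <= l)%N by rewrite hl.
have [V [i [redV i_inj Vi]]] :=
  reducing_selection f0 delta_gt0 fin hn hd hmn le_d hL.1 (independent_kernel hL) le_l.
(* The selected indices are distinct but unordered. Sorting them gives a strictly increasing tuple
   with the same forms, hence the same bound on |f|. *)
pose s := sort (relpre val leq) [seq i j | j <- enum 'I_n].
have size_s : size s == n by rewrite size_sort size_map size_enum_ord.
pose t := Tuple size_s.
have t_sorted : sorted ltn (map val t).
  rewrite ltn_sorted_uniq_leq /= sorted_map sort_sorted ?andbT.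
    by rewrite (map_inj_uniq val_inj) sort_uniq map_inj_uniq ?enum_uniq.
  by move=> a b; exact: leq_total.
apply: (@bigmin_inf _ _ _ _ t); first exact: t_sorted.
have [c [e [c0 e0 cP]]] := redV.
have cn0 : 0 < c * n%:R + 1 by rewrite ltr_wpDl // mulr_ge0 ?ler0n // ltW.
apply: (loja_le cn0); apply/nbhs0_l1norm; exists e => // z /cP le_c /=.
apply: le_trans (enorm_le_l1norm _) _; apply: le_trans le_c _.
set g := enorm _.
apply: (@le_trans _ _ (c * (n%:R * g))); last first.
  by rewrite mulrA ler_wpM2r ?enorm_ge0 // lerDl.
rewrite ler_wpM2l ?(ltW c0) //.
apply: l1norm_le_const => j.
have /tnthP[k ik] : i j \in t.
  by rewrite mem_sort; apply: map_f; rewrite mem_enum.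
have -> : (evp f z *m V) 0 j = linmap L t (polymap f z) 0 k.
  rewrite linmapE -ik -Vi; rewrite [LHS]mxE [RHS]mxE; apply: eq_bigr => a _.
  by rewrite [col _ _ _ _]mxE.
exact: cabs_le_enorm.
Qed.
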